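(* Let $X$ be a Banach space, let $\mathcal T$, $P$ and $WW_{X^*}(\mathbb R,X^{**})_a$ be as described in the context, and let $f\in WW_{X^*}(\mathbb R,X^{**})_a$. Assume that the $\sigma(X^{**},X^* )$-closure of $f(\mathbb R)$ is norm separable in $X^{**}$, and that for some $s\in\mathbb R$ the map $F:(B_{X^*},\sigma(X^*,X))\times(\mathcal T,w^* )\to\mathbb C$, $F(x^*,U)=\langle x^*,(Uf)(s)\rangle$, is (jointly) continuous. Then $f\in AP(\mathbb R,X^{**})$.
   Context: $W(\mathbb R)$ is the set of bounded continuous $g:\mathbb R\to\mathbb C$ whose translates $\{g(\cdot+t):t\in\mathbb R\}$ are relatively weakly compact in $C_b(\mathbb R)$. $WW_{X^*}(\mathbb R,X^{**}):=\{f\in BUC(\mathbb R,X^{**}): t\mapsto\langle x^*,f(t)\rangle\in W(\mathbb R)\ \forall x^*\in X^*\}$, viewed inside $L^1(\mathbb R,X^* )^*$ via $\langle g,f\rangle=\int_{\mathbb R}\langle g(r),f(r)\rangle\,dr$; its $w^*$-topology is $\sigma(\cdot,L^1(\mathbb R,X^* ))$. $\{T(t)\}_{t\in\mathbb R}$ is the translation group $(T(t)f)(r)=f(r+t)$ on this space, and $\mathcal T$ is the closure of $\{T(t)\}$ in the topology of pointwise $w^*$-convergence ($U_\alpha\to U$ iff $\langle g,U_\alpha f\rangle\to\langle g,Uf\rangle$ for all $g\in L^1(\mathbb R,X^* )$, $f\in WW_{X^*}(\mathbb R,X^{**})$); it consists of operators on $WW_{X^*}(\mathbb R,X^{**})$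 and is a compact semigroup under composition. $P$ is a minimal idempotent of $\mathcal T$ (an idempotent such that every idempotent $Q\in\mathcal T$ with $PQ=Q$ satisfies $QP=P$), and $WW_{X^*}(\mathbb R,X^{**})_a:=P\,WW_{X^*}(\mathbb R,X^{**})$. $AP(\mathbb R,Z)$ denotes the continuous functions $\mathbb R\to Z$ whose set of translates is relatively compact in the sup norm (Bohr almost periodic functions). *)

(* Defs.v *)
From HB Require Import structures.
From mathcomp Require Import all_boot all_order all_algebra.
From mathcomp Require Import all_classical all_reals all_analysis.
From mathcomp Require Export complex.
Import Order.TTheory GRing.Theory Num.Theory.
Import numFieldNormedType.Exports numFieldTopology.Exports.
Set Implicit Arguments.
Unset Strict Implicit.
Unset Printing Implicit Defensive.
Local Open Scope ring_scope.
Local Open Scope classical_set_scope.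

(* The complex field R[i] with its usual (modulus) topology / normed
   structure, as for every numFieldType in mathcomp-analysis. *)
HB.instance Definition _ (R : realType) :=
  PseudoPointedMetric.copy R[i] (R[i])^o.
HB.instance Definition _ (R : realType) :=
  NormedModule.copy R[i] (R[i])^o.

Section Banach.
Variables (R : realType) (X : completeNormedModType R[i]).
Local Notation C := R[i].

Definition nC (z : C) : R := complex.Re `|z|.
Definition nX (x : X) : R := complex.Re `|x|.

Definition is_dual (phi : X -> C) : Prop :=
  (forall (a : C) (x y : X), phi (a *: x + y) = a * phi x + phi y)
  /\ continuous phi.
Definition dual := {phi : X -> C | is_dual phi}.
HB.instance Definition _ := gen_eqMixin dual.
HB.instance Definition _ := gen_choiceMixin dual.

Definition dnorm (phi : X -> C) : R :=
  sup [set nC (phi x) | x in [set x | nX x <= 1]].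

Definition is_bidual (Phi : dual -> C) : Prop :=
  (forall (a : C) (p q r : dual),
      (forall x, sval r x = a * sval p x + sval q x) ->
      Phi r = a * Phi p + Phi q)
  /\ exists M : R, forall p : dual, nC (Phi p) <= M * dnorm (sval p).
Definition bidual := {Phi : dual -> C | is_bidual Phi}.
HB.instance Definition _ := gen_eqMixin bidual.
HB.instance Definition _ := gen_choiceMixin bidual.

Definition bnorm (Phi : dual -> C) : R :=
  sup [set nC (Phi p) | p in [set p : dual | dnorm (sval p) <= 1]].

Definition dual_sub (p q : dual) : X -> C := fun x => sval p x - sval q x.
Definition bidual_sub (Phi Psi : bidual) : dual -> C :=
  fun p => sval Phi p - sval Psi p.

Definition simple_dual (s : R -> dual) : Prop :=
  finite_set (range s) /\ forall y : dual, measurable (s @^-1` [set y]).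

Definition strongly_measurable (g : R -> dual) : Prop :=
  exists s : nat -> R -> dual, (forall n, simple_dual (s n)) /\
    {ae (@lebesgue_measure R), forall r,
       (fun n => dnorm (dual_sub (s n r) (g r))) @ \oo --> (0 : R)}.

Definition is_L1_dual (g : R -> dual) : Prop :=
  strongly_measurable g /\
  (\int[(@lebesgue_measure R)]_r (dnorm (sval (g r)))%:E < +oo)%E.
Definition L1d := {g : R -> dual | is_L1_dual g}.
HB.instance Definition _ := gen_eqMixin L1d.
HB.instance Definition _ := gen_choiceMixin L1d.

Definition pairing (g : R -> dual) (f : R -> bidual) : C :=
  ((Rintegral (@lebesgue_measure R) setT
      (fun r => complex.Re (sval (f r) (g r))))%:C
   + 'i * (Rintegral (@lebesgue_measure R) setT
      (fun r => complex.Im (sval (f r) (g r))))%:C)%C.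

Definition supnorm (h : R -> C) : R := sup (range (fun r => nC (h r))).
Definition is_Cb (h : R -> C) : Prop :=
  (exists M : R, forall r, nC (h r) <= M) /\ continuous h.
Definition Cb := {h : R -> C | is_Cb h}.
HB.instance Definition _ := gen_eqMixin Cb.
HB.instance Definition _ := gen_choiceMixin Cb.

Definition is_Cb_dual (mu : Cb -> C) : Prop :=
  (forall (a : C) (h1 h2 h3 : Cb),
      (forall r, sval h3 r = a * sval h1 r + sval h2 r) ->
      mu h3 = a * mu h1 + mu h2)
  /\ exists M : R, forall h : Cb, nC (mu h) <= M * supnorm (sval h).
Definition Cb_dual := {mu : Cb -> C | is_Cb_dual mu}.
HB.instance Definition _ := gen_eqMixin Cb_dual.
HB.instance Definition _ := gen_choiceMixin Cb_dual.

Definition Cb_weak_map (h : Cb) : {ptws Cb_dual -> C} := fun mu => sval mu h.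
Definition Cb_weak := initial_topology Cb_weak_map.

Definition in_W (g : R -> C) : Prop :=
  is_Cb g /\
  compact (closure [set h : Cb_weak | exists t : R,
                                  sval h = (fun r => g (r + t))]).

Definition is_BUC (f : R -> bidual) : Prop :=
  (exists M : R, forall r, bnorm (sval (f r)) <= M) /\
  forall e : R, 0 < e -> exists2 d : R, 0 < d &
    forall r s : R, `|r - s| < d -> bnorm (bidual_sub (f r) (f s)) < e.

Definition in_WW (f : R -> bidual) : Prop :=
  is_BUC f /\ forall p : dual, in_W (fun r => sval (f r) p).
Definition WW := {f : R -> bidual | in_WW f}.
HB.instance Definition _ := gen_eqMixin WW.
HB.instance Definition _ := gen_choiceMixin WW.

Definition Ops := WW -> WW.
Definition ops_map (U : Ops) : {ptws (WW * L1d) -> C} :=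
  fun q => pairing (sval q.2) (sval (U q.1)).
Definition OpsW := initial_topology ops_map.

Definition translations : set OpsW :=
  [set U | exists t : R, forall f : WW, sval (U f) = (fun r => sval f (r + t))].

Definition Tcl : set OpsW := closure translations.

Definition idempotent_op (Q : OpsW) : Prop := forall f : WW, Q (Q f) = Q f.

Definition minimal_idempotent (P : OpsW) : Prop :=
  Tcl P /\ idempotent_op P /\
  forall Q : OpsW, Tcl Q -> idempotent_op Q ->
    (forall f : WW, P (Q f) = Q f) -> forall f : WW, Q (P f) = P f.

Definition WW_a (P : OpsW) : set WW := [set f | exists h : WW, f = P h].

Definition BX := {p : dual | dnorm (sval p) <= 1}.
HB.instance Definition _ := gen_eqMixin BX.
HB.instance Definition _ := gen_choiceMixin BX.
Definition BX_map (b : BX) : {ptws X -> C} := sval (sval b).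
Definition BXw := initial_topology BX_map.

Definition Tsub := {U : OpsW | Tcl U}.
HB.instance Definition _ := gen_eqMixin Tsub.
HB.instance Definition _ := gen_choiceMixin Tsub.
Definition Tw := initial_topology (fun U : Tsub => (sval U : OpsW)).

Definition Fjoint (f : WW) (s : R) : BXw * Tw -> C :=
  fun q => sval (sval ((sval q.2 : OpsW) f) s) (sval q.1).

Definition bidual_wmap (Phi : bidual) : {ptws dual -> C} := sval Phi.
Definition bidual_w := initial_topology bidual_wmap.

Definition norm_separable (K : set bidual) : Prop :=
  exists D : set bidual, countable D /\ D `<=` K /\
    forall Phi, K Phi -> forall e : R, 0 < e ->
      exists2 d, D d & bnorm (bidual_sub Phi d) < e.

(* the sup-norm topology on functions R -> X^**, via the isometric embedding
   h |-> ((r, x^* ) |-> h(r)(x^* )) into the uniform (sup) topology on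
   R * B_{X^*} -> C *)
Definition sup_map (h : R -> bidual) : {uniform (R * BX) -> C} :=
  fun q => sval (h q.1) (sval q.2).
Definition Rbidual_sup := initial_topology sup_map.

Definition is_AP (f : R -> bidual) : Prop :=
  (forall r e : R, 0 < e -> exists2 d : R, 0 < d &
     forall s : R, `|s - r| < d -> bnorm (bidual_sub (f s) (f r)) < e)
  /\ compact (closure [set h : Rbidual_sup | exists t : R,
                                       h = (fun r => f (r + t))]).

End Banach.

(* Main.v *)
Require Import Defs.
From HB Require Import structures.
From mathcomp Require Import all_boot all_order all_algebra.
From mathcomp Require Import all_classical all_reals all_analysis.
From mathcomp Require Import complex.
From mathcomp Require Import measurable_realfun ring lra.
Import Order.TTheory GRing.Theory Num.Theory.
Import numFieldNormedType.Exports numFieldTopology.Exports.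
Set Implicit Arguments.
Unset Strict Implicit.
Unset Printing Implicit Defensive.
Local Open Scope ring_scope.
Local Open Scope classical_set_scope.

(* Elements of T are limits U f of translates of f along ultrafilters on R, and
   composition of operators is convolution of ultrafilters. If U is in T, the left
   ideal generated by U P contains an idempotent (Ellis-Numakura), and minimality of P
   then yields W in T with W U f = f.

   For g = <x*, f>, weak compactness of the translates makes every orbit limit of g
   equicontinuous with respect to finitely many rational translates of g. By Baire
   category, translation is then uniformly almost constant on some nonempty set of
   translates of g that is open for pointwise convergence; reversibility brings the
   translates of g along any ultrafilter into that set, so they are uniformly Cauchy.

   Finally, F is continuous on the compact space B_{X*} x T, so {<x*, f> : x* in B_{X*}}
   is totally bounded in the sup norm. Finitely many functionals therefore suffice, and
   the translates of f themselves are uniformly Cauchy along every ultrafilter. *)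

(** * Limits along filters and ultrafilters *)

(** Operators in the closure are given without any continuity that would let limits pass through
    them, so their products are awkward to compute directly. Ultrafilters on [R] as a discrete group
    remove the difficulty: every bounded function has a limit along each of them, and a product
    becomes an iterated limit of translates. [P f = f] alone would not be enough. The open set found
    by Baire category sits around an uncontrolled translate [t0], and to reach it from an arbitrary
    limit [act U f] there must be a way back from that limit to [f]. The sets on which scalar
    translates are uniformly close depend on the functional, and only finitely many members of an
    ultrafilter can be intersected; this is what joint continuity has to repair. *)

Section Modulus.
Variable R : realType.
Implicit Types z w : R[i].

Lemma nCE z : `|z| = (nC z)%:C%C.
Proof. by rewrite /nC normc_def. Qed.

Lemma nC_ge0 z : 0 <= nC z.
Proof. by rewrite /nC normc_def /= sqrtr_ge0. Qed.

Lemma nC0 : nC (0 : R[i]) = 0.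
Proof. by rewrite /nC normr0. Qed.

Lemma nC_eq0 z : nC z = 0 -> z = 0.
Proof. by move=> z0; apply/eqP; rewrite -normr_eq0 nCE z0. Qed.

Lemma nCD z w : nC (z + w) <= nC z + nC w.
Proof. by have := ler_normD z w; rewrite !nCE -rmorphD lecR. Qed.

Lemma nCN z : nC (- z) = nC z.
Proof. by rewrite /nC normrN. Qed.

Lemma nCC z w : nC (z - w) = nC (w - z).
Proof. by rewrite -nCN opprB. Qed.

Lemma nCM z w : nC (z * w) = nC z * nC w.
Proof. by apply: (@complexI R); rewrite rmorphM -!nCE normrM. Qed.

Lemma nC_triangle (u z w : R[i]) : nC (z - w) <= nC (z - u) + nC (u - w).
Proof. by rewrite -{1}(subrK u z) -addrA; exact: nCD. Qed.

Lemma nC_real (a : R) : nC a%:C%C = `|a|.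
Proof. by rewrite /nC normc_def /= expr0n addr0 sqrtr_sqr. Qed.

Lemma nC_Re z : `|complex.Re z| <= nC z.
Proof.
by rewrite /nC normc_def /= -sqrtr_sqr ler_wsqrtr// lerDl sqr_ge0.
Qed.

Lemma nC_Im z : `|complex.Im z| <= nC z.
Proof.
by rewrite /nC normc_def /= -sqrtr_sqr ler_wsqrtr// lerDr sqr_ge0.
Qed.

Lemma nC_ReIm z : nC z <= `|complex.Re z| + `|complex.Im z|.
Proof.
rewrite {1}(complexE z); apply: (le_trans (nCD _ _)).
rewrite nCM !nC_real; have -> : nC 'i%C = 1 :> R.
  by rewrite /nC normc_def /= expr0n expr1n add0r sqrtr1.
by rewrite mul1r.
Qed.

End Modulus.

Lemma filterSr {T : Type} {F : set_system T} {FF : Filter F} {A B : set T} :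
  F A -> A `<=` B -> F B.
Proof. by move=> FA AB; exact: filterS FA. Qed.

Section FilterLimits.
Variable R : realType.

(** Stated with the real modulus [nC], so that tolerances are real numbers and real arithmetic
    applies directly. *)
Definition ucv {I : Type} (F : set_system I) (psi : I -> R[i]) (z : R[i]) :=
  forall e : R, 0 < e -> F [set t | nC (psi t - z) < e].

Lemma cvg_ucv {I : Type} (F : set_system I) {FF : Filter F} psi z :
  psi @ F --> z <-> ucv F psi z.
Proof.
split=> [/cvgrPdist_lt h e e0|h].
  have e0C : 0 < e%:C%C by rewrite ltcR.
  have he := h _ e0C; move: he.
  by apply: filterS => t /=; rewrite nCE ltcR nCC.
(* A positive element of [R[i]] has zero imaginary part, so the tolerance is a real [a]. *)
apply/cvgrPdist_lt => e; case: e => a b; rewrite ltcE /= => /andP[/eqP -> a0].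
by refine (filterSr (h a a0) _) => t /=; rewrite nCE nCC ltcR.
Qed.

Variables (I : Type) (F : set_system I).
Context {PF : ProperFilter F}.
Implicit Types psi phi : I -> R[i].

Lemma ucv_le {psi z c} : ucv F psi z -> F [set t | nC (psi t) <= c] -> nC z <= c.
Proof.
move=> h hc; rewrite leNgt; apply/negP => cz.
have /filterI /(_ hc) /filter_ex [t [/= h1 h2]] := h (nC z - c) ltac:(lra).
have := nCD (z - psi t) (psi t); rewrite subrK nCC; lra.
Qed.

Lemma ucv_ge {psi z c} : ucv F psi z -> F [set t | c <= nC (psi t)] -> c <= nC z.
Proof.
move=> h hc; rewrite leNgt; apply/negP => cz.
have /filterI /(_ hc) /filter_ex [t [/= h1 h2]] := h (c - nC z) ltac:(lra).
have := nCD (psi t - z) z; rewrite subrK; lra.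
Qed.

Lemma ucv_cst z : ucv F (fun=> z) z.
Proof.
by move=> e e0; apply: (@filterE _ F) => t /=; rewrite subrr nC0.
Qed.

Lemma ucv_lin (a : R[i]) {psi phi z w} : ucv F psi z -> ucv F phi w ->
  ucv F (fun t => a * psi t + phi t) (a * z + w).
Proof.
move=> h1 h2 e e0; have a0 := nC_ge0 a.
have d0 : 0 < e / (2 * (nC a + 1)) by rewrite divr_gt0//; lra.
have e20 : 0 < e / 2 by lra.
refine (filterSr (filterI (h1 _ d0) (h2 _ e20)) _) => t /= [].
rewrite ltr_pdivlMr; last lra.
have -> : a * psi t + phi t - (a * z + w) = a * (psi t - z) + (phi t - w) by ring.
move: (psi t - z) (phi t - w) => u v hu hv.
have := nCD (a * u) v; rewrite nCM; have := nC_ge0 u; nra.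
Qed.

Lemma ucvB psi phi z w : ucv F psi z -> ucv F phi w ->
  ucv F (fun t => psi t - phi t) (z - w).
Proof.
move=> h1 h2; have := ucv_lin (-1) h2 h1.
rewrite mulN1r addrC; congr (ucv F _ _); apply/funext => t.
by rewrite mulN1r addrC.
Qed.

Lemma ucv_unique {psi z w} : ucv F psi z -> ucv F psi w -> z = w.
Proof.
move=> h1 h2; apply/eqP; rewrite -subr_eq0; apply/eqP/nC_eq0.
apply/eqP; rewrite eq_le nC_ge0 andbT.
apply: (ucv_le (ucvB h1 h2)); apply: (@filterE _ F) => t /=.
by rewrite subrr nC0.
Qed.

Lemma ucv_ext {psi phi z} : psi =1 phi -> ucv F psi z -> ucv F phi z.
Proof. by move=> /funext ->. Qed.

Definition ulim psi : R[i] := xget 0 [set z | ucv F psi z].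

Lemma ulimE {psi z} : ucv F psi z -> ulim psi = z.
Proof.
by move=> h; apply: (ucv_unique _ h); rewrite /ulim; case: xgetP => [y -> //|/(_ z)].
Qed.

End FilterLimits.
Arguments ulim {R I} F psi.

Section Ultrafilters.

Lemma ultra_fmap (I J : Type) (f : I -> J) (F : set_system I) :
  UltraFilter F -> UltraFilter (f @ F).
Proof.
move=> UF; split=> [|G PG FG]; first exact: fmap_proper_filter.
rewrite eqEsubset; split=> // A GA.
have [//|h] := in_ultra_setVsetC (f @^-1` A) UF.
have /FG GNA : (f @ F) (~` A) by [].
by have [x []] := filter_ex (filterI GA GNA).
Qed.

Lemma ultra_setC {I} {F : set_system I} (A : set I) :
  UltraFilter F -> ~ F A -> F (~` A).
Proof. by move=> UF; have [|] := in_ultra_setVsetC A UF. Qed.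

Lemma fip_ultra {I} (B : set (set I)) :
  B !=set0 -> (forall X, B X -> X !=set0) ->
  (forall X Y, B X -> B Y -> exists2 Z, B Z & Z `<=` X `&` Y) ->
  exists U : set_system I, UltraFilter U /\ B `<=` U.
Proof.
move=> [X0 BX0] Bn BI.
have PB : ProperFilter (filter_from B id).
  apply: filter_from_proper; last exact: Bn.
  apply: filter_from_filter => [|X Y]; [by exists X0|exact: BI].
have [U [UU BU]] := ultraFilterLemma PB.
by exists U; split=> // X BX; apply: BU; exists X.
Qed.

(* Compactness of the Stone-Cech compactification of a discrete space. *)
Lemma ultra_finite_cover {I : eqType} (D : I -> I -> Prop) :
  (forall U : set_system I, UltraFilter U -> exists a0, U (D a0)) ->
  exists L : seq I, forall a, exists2 a0, a0 \in L & D a0 a.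
Proof.
move=> h; apply: contrapT => /forallNP nL.
pose N (L : seq I) := [set a | forall a0, a0 \in L -> ~ D a0 a].
have [||X Y [L _ <-] [L' _ <-]|U [UU NU]] := @fip_ultra I (range N).
- by exists (N nil), nil.
- move=> _ [L _ <-]; have /existsNP [a /forall2NP ha] := nL L; exists a => a0.
  by have [] := ha a0.
- exists (N (L ++ L')%SEQ); first by exists (L ++ L')%SEQ.
  by move=> a ha; split=> a0 h0; apply: ha; rewrite mem_cat h0 ?orbT.
have [a0 Ua0] := h U UU.
have /NU Ua0' : range N (N [:: a0]) by exists [:: a0].
have [a [ha hn]] := filter_ex (filterI Ua0 Ua0').
by apply: (hn a0) => //; rewrite inE.
Qed.

Lemma ucv_bounded (R : realType) {I : Type} {F : set_system I} (psi : I -> R[i]) (M : R) :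
  UltraFilter F -> (forall t, nC (psi t) <= M) -> ucv F psi (ulim F psi).
Proof.
move=> UF hM.
have real_cv (u : I -> R) : (forall t, `|u t| <= M) -> exists x : R, u @ F --> x.
  move=> hu; have /= := @segment_compact R (- M) M; rewrite compact_ultra.
  move=> /(_ (u @ F) (ultra_fmap u UF)).
  have h : (u @ F) `[- M, M]%classic.
    by apply: (@filterE _ F) => t /=; rewrite in_itv /= -ler_norml.
  by move=> /(_ h) [x [_ hx]]; exists x.
have [x hx] := real_cv (fun t => complex.Re (psi t)) (fun t => le_trans (nC_Re _) (hM t)).
have [y hy] := real_cv (fun t => complex.Im (psi t)) (fun t => le_trans (nC_Im _) (hM t)).
suff h : ucv F psi (x +i* y)%C by rewrite (ulimE h).
move=> e e0.
move/cvgrPdist_lt : hx => /(_ (e / 2) ltac:(lra)) h1.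
move/cvgrPdist_lt : hy => /(_ (e / 2) ltac:(lra)) h2.
refine (filterSr (filterI h1 h2) _) => t /= [].
move: (psi t) => [a b] /=; rewrite distrC => ha; rewrite distrC => hb.
apply: le_lt_trans (nC_ReIm _) _ => /=; lra.
Qed.

End Ultrafilters.

(** * Convolution of ultrafilters and idempotents *)

Section Convolution.
Variable V : zmodType.
Implicit Types F G : set_system V.

(** On ultrafilters this is the product of the Stone-Cech compactification of discrete [V]: limits
    along it are iterated limits of [psi (t + s)], with [t] along [F] taken last. *)
Definition fconv F G : set_system V := [set A | F [set t | G [set s | A (t + s)]]].

Lemma fconv_filter F G : ProperFilter F -> ProperFilter G -> ProperFilter (fconv F G).
Proof.
move=> PF PG; split.
  move=> h; have /filter_ex [t] : F [set t | G [set s | set0 (t + s)]] by [].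
  by move=> /filter_ex [].
split.
- by apply: (@filterE _ F) => t; apply: (@filterE _ G).
- move=> A B FA FB; refine (filterSr (F:=F) (@filterI _ F _ _ _ FA FB) _) => t [ha hb].
  exact: (@filterI _ G _ _ _ ha hb).
- move=> A B AB h; refine (filterSr (F:=F) h _) => t /= h2.
  by refine (filterSr (F:=G) h2 _) => s; exact: AB.
Qed.

Lemma fconv_ultra F G : UltraFilter F -> UltraFilter G -> UltraFilter (fconv F G).
Proof.
move=> UF UG; split=> [|H PH FH]; first exact: fconv_filter.
rewrite eqEsubset; split=> // A HA; apply: contrapT => nA.
have : fconv F G (~` A).
  refine (filterSr (F:=F) (ultra_setC UF nA) _) => t /= nt.
  exact: (ultra_setC UG nt).
by move=> /FH hA; have [x []] := filter_ex (filterI HA hA).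
Qed.


Let subidem (F : set_system V) := F `<=` fconv F F.

Lemma fconv_sub F G F' G' : Filter F -> F `<=` F' -> G `<=` G' -> fconv F G `<=` fconv F' G'.
Proof.
move=> FF sF sG A h; apply: sF; refine (filterSr (F:=F) h _) => t /=; exact: sG.
Qed.

(** Larger filters represent smaller closed sets, so maximality here is the existence of a minimal
    closed subsemigroup. Chains are bounded by their unions. *)
Lemma maximal_subidem (F0 : set_system V) : ProperFilter F0 -> subidem F0 ->
  exists F : set_system V, [/\ ProperFilter F, F0 `<=` F, subidem F &
    forall G, ProperFilter G -> subidem G -> F `<=` G -> G = F].
Proof.
move=> PF0 iF0.
set T := ({G : set_system V & [/\ ProperFilter G, F0 `<=` G & subidem G]}).
pose ord := fun G1 G2 : {classic T} => `[< projT1 G1 `<=` projT1 G2 >].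
pose t0 : T := existT _ F0 (And3 PF0 (fun _ => id) iF0).
suff [G Gmax] : exists G : {classic T}, premaximal ord G.
  have [PG sG iG] := projT2 G; exists (projT1 G); split=> // H PH iH sH.
  have tH : [/\ ProperFilter H, F0 `<=` H & subidem H] by split=> // A /sG /sH.
  rewrite eqEsubset; split=> //.
  have := Gmax (existT _ H tH); rewrite /ord /= => h.
  by have /asboolP := h ltac:(exact/asboolP).
apply: (ZL_preorder t0).
- by move=> t; exact/asboolP.
- by move=> r s t /asboolP sr /asboolP st; exact/asboolP/(subset_trans _ st).
move=> A Atot; have [[G AG]|A0] := pselect (A !=set0); last first.
  by exists t0 => G AG; exfalso; apply: A0; exists G.
have tU : [/\ ProperFilter (\bigcup_(H in A) projT1 H),
    F0 `<=` \bigcup_(H in A) projT1 H & subidem (\bigcup_(H in A) projT1 H)].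
  split.
  - apply: Build_ProperFilter_ex.
      by move=> B [H AH HB]; have [PH _ _] := projT2 H; exact: filter_ex HB.
    split.
    + by exists G => //; have [PG _ _] := projT2 G; exact: filterT.
    + move=> B C [HB AHB HBB] [HC AHC HCC].
      have [/asboolP s|/asboolP s] := Atot _ _ AHB AHC.
        by exists HC => //; have [? _ _] := projT2 HC; apply: filterI => //; exact: s.
      by exists HB => //; have [? _ _] := projT2 HB; apply: filterI => //; exact: s.
    + move=> B C sBC [H AH HB]; exists H => //; have [? _ _] := projT2 H.
      exact: filterS HB.
  - by move=> B F0B; exists G => //; have [_ s _] := projT2 G; exact: s.
  - move=> B [H AH HB]; have [PH _ iH] := projT2 H.
    exists H => //; refine (@filterSr _ (projT1 H) _ _ _ (iH _ HB) _) => t /= ht; by exists H.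
exists (existT _ (\bigcup_(H in A) projT1 H) tU) => H AH.
by apply/asboolP => B HB /=; exists H.
Qed.

(* Ellis-Numakura in the Stone-Cech compactification of a discrete group: closed
   subsemigroups correspond to filters contained in their own convolution
   square, and a maximal such filter is an idempotent ultrafilter. *)
Lemma idempotent_ultrafilter (F0 : set_system V) : ProperFilter F0 ->
  F0 `<=` fconv F0 F0 ->
  exists U, [/\ UltraFilter U, F0 `<=` U & fconv U U = U].
Proof.
move=> PF0 iF0; have [F [PF sF iF maxF]] := maximal_subidem PF0 iF0.
have [U [UU FU]] := ultraFilterLemma PF.
exists U; split=> //; first exact: subset_trans FU.
have PFU : ProperFilter (fconv F U) by exact: fconv_filter.
(* Let C be the set of ultrafilters containing [F]. Then [fconv F U] represents the product set C U,
   a closed subsemigroup inside C, and minimality gives C U = C. *)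
have FUF : fconv F U = F.
  apply: maxF.
  - move=> A hA.
    have sFG : F `<=` fconv F U.
      move=> B /iF; exact: fconv_sub.
    refine (@filterSr _ (fconv F U) _ _ _ (sFG _ (iF _ hA)) _) => t /= ht.
    refine (filterSr (F:=F) ht _) => s /= hs.
    by refine (filterSr (F:=U) hs _) => r /=; rewrite addrA.
  - by move=> B /iF; exact: fconv_sub.
(* The filter generated by [base] represents the V in C with V U = U. This set is nonempty because U
   lies in C = C U, and it is a closed subsemigroup; by minimality it is C, so it contains U
   itself. *)
pose B (A : set V) := [set t | U [set s | A (t + s)]].
pose base := [set X | exists D A, [/\ F D, U A & X = D `&` B A]].
have PH : ProperFilter (filter_from base id).
  apply: filter_from_proper.
    apply: filter_from_filter.
      by exists (setT `&` B setT), setT, setT; split=> //; exact: filterT.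
    move=> _ _ [D [A [FD UA ->]]] [D' [A' [FD' UA' ->]]].
    exists ((D `&` D') `&` B (A `&` A')).
      by exists (D `&` D'), (A `&` A'); split=> //; exact: filterI.
    move=> t [[dt dt'] bt]; split; split=> //; apply: filterS bt => s /= [] //.
  move=> _ [D [A [FD UA ->]]]; apply/set0P/eqP => e0.
  have : fconv F U (~` A).
    refine (filterSr (F:=F) FD _) => t dt /=; apply: (ultra_setC UU) => ht.
    by have : set0 t by rewrite -e0.
  by rewrite FUF => /FU hA; have [x []] := filter_ex (filterI UA hA).
have FH : F `<=` filter_from base id.
  move=> D FD; exists (D `&` B setT); last by move=> t [].
  by exists D, setT; split=> //; exact: filterT.
have eH : filter_from base id = F.
  apply: maxF => // X [_ [D [A [FD UA ->]]] sX].
  have h1 : fconv (filter_from base id) (filter_from base id) D.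
    by apply: (@fconv_sub F F) => //; exact: iF.
  have h2 : filter_from base id (B A).
    exists (setT `&` B A); last by move=> t [].
    by exists setT, A; split=> //; exact: filterT.
  refine (@filterSr _ (filter_from base id) _ _ _
    (@filterI _ (filter_from base id) _ _ _ h1 h2) _) => t [h3 h4] /=.
  have h5 : filter_from base id [set s | B A (t + s)].
    exists (setT `&` B [set s | A (t + s)]).
      by exists setT, [set s | A (t + s)]; split=> //; exact: filterT.
    by move=> s [_] hs; refine (filterSr (F:=U) hs _) => r /=; rewrite addrA.
  by refine (filterSr (filterI h3 h5) _) => s [? ?]; exact: sX.
apply: (max_filter (UltraFilter := UU)); first exact: fconv_filter.
move=> A UA; apply: FU; rewrite -eH; exists (setT `&` B A); last by move=> t [].
by exists setT, A; split=> //; exact: filterT.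
Qed.

End Convolution.

(** * Weak topologies and dual norms *)

Section InitialTopologies.

Lemma initial_cvg (S : choiceType) (T : topologicalType) (w : S -> T) (I : Type)
    (F : set_system I) {FF : Filter F} (u : I -> initial_topology w)
    (s : initial_topology w) :
  u @ F --> s <-> (w \o u) @ F --> w s.
Proof.
split=> [h|h A].
  by apply: (cvg_comp _ _ h); exact: initial_continuous.
move=> [B [[C oC <-] Cs] BA].
have h1 : nbhs (w s) C by exact: open_nbhs_nbhs.
have h2 := h _ h1.
by refine (filterSr (F := F) h2 _) => i; exact: BA.
Qed.

Lemma ptws_cvg (T : Type) (V : topologicalType) (I : Type) (F : set_system I)
    {FF : Filter F} (u : I -> {ptws T -> V}) (s : {ptws T -> V}) :
  u @ F --> s <-> forall t, (fun i => u i t) @ F --> s t.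
Proof.
rewrite cvg_sup; split=> h t.
  by have /initial_cvg := h t.
have := h t => ht.
have := @initial_cvg _ _ (fun f : T -> V => f t) I F FF u s.
by move=> [_]; apply.
Qed.

(** [Cb_weak], [BXw] and [OpsW] are all initial for a map into functions with pointwise convergence,
    so this one criterion serves for each of them. *)
Lemma initial_ptws_cvg (R : realType) (S : choiceType) (T : Type)
    (w : S -> {ptws T -> R[i]}) (I : Type) (F : set_system I) {FF : Filter F}
    (u : I -> initial_topology w) (s : initial_topology w) :
  u @ F --> s <-> forall t, ucv F (fun i => w (u i) t) (w s t).
Proof.
rewrite initial_cvg ptws_cvg; split=> h t; have ht := h t.
  by apply/cvg_ucv; exact: ht.
by apply/cvg_ucv.
Qed.

End InitialTopologies.

Lemma sval_inj (T : Type) (P : T -> Prop) : injective (@sval T P).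
Proof.
move=> [x px] [y py] /= xy; subst y.
by rewrite (Prop_irrelevance px py).
Qed.

Section Norms.
Variables (R : realType) (X : completeNormedModType R[i]).
Implicit Types (x : X) (p q : dual X).

Lemma sup_image_le (T : Type) (P : set T) (phi : T -> R) (c : R) :
  P !=set0 -> (forall t, P t -> phi t <= c) -> sup [set phi t | t in P] <= c.
Proof.
move=> [t Pt] h; apply: ge_sup; first by exists (phi t), t.
by move=> _ [s Ps <-]; exact: h.
Qed.

Lemma le_sup_image (T : Type) (P : set T) (phi : T -> R) (c : R) t :
  (forall t, P t -> phi t <= c) -> P t -> phi t <= sup [set phi t | t in P].
Proof.
move=> h Pt; apply: ub_le_sup; last by exists t.
by exists c => _ [s Ps <-]; exact: h.
Qed.

Lemma nXE x : `|x| = (nX x)%:C%C.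
Proof.
by rewrite /nX RRe_real//; apply: ger0_real.
Qed.

Lemma nX_ge0 x : 0 <= nX x.
Proof. by have := normr_ge0 x; rewrite nXE lecR. Qed.

Lemma nX0 : nX (0 : X) = 0.
Proof. by rewrite /nX normr0. Qed.

Lemma nX_eq0 x : nX x = 0 -> x = 0.
Proof. by move=> h; apply/eqP; rewrite -normr_eq0 nXE h. Qed.

Lemma nXZ (a : R[i]) x : nX (a *: x) = nC a * nX x.
Proof. by apply: (@complexI R); rewrite [RHS]rmorphM /= -!nXE -nCE normrZ. Qed.

Lemma is_dual0 (phi : X -> R[i]) : is_dual phi -> phi 0 = 0.
Proof.
move=> [h _]; have := h 1 0 0; rewrite scale1r addr0 mul1r => e.
by apply: (addrI (phi 0)); rewrite -e addr0.
Qed.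

Lemma is_dualZ (phi : X -> R[i]) a x : is_dual phi -> phi (a *: x) = a * phi x.
Proof.
by move=> h; have := h.1 a x 0; rewrite (is_dual0 h) !addr0.
Qed.

Lemma dual_bounded (phi : X -> R[i]) : is_dual phi ->
  exists2 M : R, 0 <= M & forall x, nC (phi x) <= M * nX x.
Proof.
move=> h; have c0 : continuous_at 0 phi by exact: h.2.
have /cvg_ucv h1 : phi @ nbhs 0 --> phi 0 by exact: c0.
have := h1 1 ltr01; rewrite (is_dual0 h) => /nbhs_normP [[d d'] /=].
rewrite ltcE /= => /andP[/eqP -> d0] hd.
have hd' y : nX y < d -> nC (phi y) < 1.
  move=> hy; have := hd y; rewrite /= subr0; apply.
  by rewrite /ball_ /= sub0r normrN nXE ltcR.
(* Rescaling [x] to norm [d / 2], inside the ball where [phi] stays below 1, produces this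
   constant. *)
exists (2 / d) => [|x]; first by rewrite divr_ge0//; lra.
have [/nX_eq0 ->|x0] := eqVneq (nX x) 0.
  by rewrite (is_dual0 h) nC0 nX0 mulr0.
have xp : 0 < nX x by rewrite lt_def x0 nX_ge0.
have k0 : 0 < d / (2 * nX x) by rewrite divr_gt0//; lra.
have := hd' ((d / (2 * nX x))%:C%C *: x).
rewrite nXZ nC_real gtr0_norm// (is_dualZ _ _ h) nCM nC_real gtr0_norm//.
have -> : d / (2 * nX x) * nX x = d / 2 by field.
move=> /(_ ltac:(lra)); rewrite mulrC -ltr_pdivlMr// div1r invf_div => hh.
by apply: ltW; rewrite mulrAC.
Qed.

Let unit_ball : [set x : X | nX x <= 1] !=set0.
Proof. by exists 0; rewrite /= nX0 ler01. Qed.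

Lemma dnorm_ge0 (phi : X -> R[i]) : is_dual phi -> 0 <= dnorm phi.
Proof.
move=> h; have [M M0 hM] := dual_bounded h.
have <- : nC (phi 0) = 0 by rewrite is_dual0// nC0.
apply: (@le_sup_image X [set x | nX x <= 1] (fun x => nC (phi x)) M).
  by move=> y /= hy; apply: le_trans (hM y) _; nra.
by rewrite /= nX0 ler01.
Qed.

Lemma dnorm_ub (phi : X -> R[i]) x : is_dual phi -> nC (phi x) <= dnorm phi * nX x.
Proof.
move=> h; have [M M0 hM] := dual_bounded h.
have hb y : nX y <= 1 -> nC (phi y) <= dnorm phi.
  move=> hy; apply: (@le_sup_image X [set x | nX x <= 1] (fun x => nC (phi x)) M) => //.
  by move=> z /= hz; apply: le_trans (hM z) _; nra.
have [/nX_eq0 ->|x0] := eqVneq (nX x) 0.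
  by rewrite (is_dual0 h) nC0 nX0 mulr0.
have xp : 0 < nX x by rewrite lt_def x0 nX_ge0.
have k0 : 0 < (nX x)^-1 by rewrite invr_gt0.
have := hb ((nX x)^-1%:C%C *: x).
rewrite nXZ nC_real gtr0_norm// mulVf// lexx => /(_ isT).
by rewrite (is_dualZ _ _ h) nCM nC_real gtr0_norm// ler_pdivrMl// mulrC.
Qed.

Lemma dnorm_le (phi : X -> R[i]) c :
  (forall x, nX x <= 1 -> nC (phi x) <= c) -> dnorm phi <= c.
Proof. by move=> h; exact: (sup_image_le unit_ball). Qed.

Lemma is_dual_lin a p q : is_dual (fun x => a * sval p x + sval q x).
Proof.
split=> [b x y|x].
  by rewrite (svalP p).1 (svalP q).1; ring.
apply/cvg_ucv; apply: ucv_lin; apply/cvg_ucv; [exact: (svalP p).2|exact: (svalP q).2].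
Qed.

Definition dual_lin a p q : dual X := exist _ _ (is_dual_lin a p q).

Lemma is_dual_0 : is_dual (fun=> 0 : R[i]) (X := X).
Proof. by split=> [a x y|x]; [rewrite mulr0 addr0|exact: cvg_cst]. Qed.

Definition dual_zero : dual X := exist _ _ is_dual_0.

Lemma dual_subE p q : dual_sub p q = sval (dual_lin (-1) q p).
Proof. by apply/funext => x /=; rewrite /dual_sub mulN1r addrC. Qed.

End Norms.

(** * Ultrafilters acting on [WW] *)

Section Biduals.
Variables (R : realType) (X : completeNormedModType R[i]).
Implicit Types (p q : dual X) (Phi : dual X -> R[i]).

Lemma dnorm_zero : dnorm (sval (dual_zero X)) = 0.
Proof.
apply/eqP; rewrite eq_le dnorm_ge0 ?andbT; last exact: svalP.
by apply: dnorm_le => x _ /=; rewrite nC0.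
Qed.

Lemma is_bidual_lin Phi a p q : is_bidual Phi ->
  Phi (dual_lin a p q) = a * Phi p + Phi q.
Proof. by move=> h; apply: h.1. Qed.

Lemma is_bidual0 Phi : is_bidual Phi -> Phi (dual_zero X) = 0.
Proof.
move=> h; have : Phi (dual_zero X) = 1 * Phi (dual_zero X) + Phi (dual_zero X).
  by apply: h.1 => x /=; rewrite mulr0 addr0.
by rewrite mul1r => e; apply: (addrI (Phi (dual_zero X))); rewrite -e addr0.
Qed.

Let bound_ball Phi M : (forall p : dual X, nC (Phi p) <= M * dnorm (sval p)) ->
  forall p : dual X, dnorm (sval p) <= 1 -> nC (Phi p) <= `|M|.
Proof.
move=> hM p hp; apply: le_trans (hM p) _.
have := dnorm_ge0 (svalP p); have := ler_norm M; have := normr_ge0 M; nra.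
Qed.

Lemma bnorm_ge0 Phi : is_bidual Phi -> 0 <= bnorm Phi.
Proof.
move=> h; have [_ [M hM]] := h.
have <- : nC (Phi (dual_zero X)) = 0 by rewrite is_bidual0// nC0.
apply: (@le_sup_image _ (dual X) [set p | dnorm (sval p) <= 1] (fun p => nC (Phi p))).
  exact: (bound_ball hM).
by rewrite /= dnorm_zero ler01.
Qed.

Lemma bnorm_le Phi c : (forall p, dnorm (sval p) <= 1 -> nC (Phi p) <= c) -> bnorm Phi <= c.
Proof.
move=> h; apply: sup_image_le => //.
by exists (dual_zero X); rewrite /= dnorm_zero ler01.
Qed.

Lemma bnorm_ub Phi p : is_bidual Phi -> nC (Phi p) <= bnorm Phi * dnorm (sval p).
Proof.
move=> h; have [_ [M hM]] := h.
have hb q : dnorm (sval q) <= 1 -> nC (Phi q) <= bnorm Phi.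
  move=> hq.
  apply: (@le_sup_image _ (dual X) [set p | dnorm (sval p) <= 1] (fun p => nC (Phi p))) => //.
  exact: (bound_ball hM).
have [p0|p0] := eqVneq (dnorm (sval p)) 0.
  by have := hM p; rewrite p0 !mulr0.
have pp : 0 < dnorm (sval p) by rewrite lt_def p0 dnorm_ge0//; exact: svalP.
have k0 : 0 < (dnorm (sval p))^-1 by rewrite invr_gt0.
have := hb (dual_lin (dnorm (sval p))^-1%:C%C p (dual_zero X)).
rewrite is_bidual_lin// is_bidual0// addr0 nCM nC_real gtr0_norm//.
rewrite ler_pdivrMl// mulrC; apply; apply: dnorm_le => x x1 /=.
rewrite addr0 nCM nC_real gtr0_norm// ler_pdivrMl// mulr1.
have := dnorm_ub x (svalP p); nra.
Qed.

Lemma is_bidual_sub (Phi Psi : bidual X) : is_bidual (bidual_sub Phi Psi).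
Proof.
split=> [a p q r h|]; rewrite /bidual_sub.
  by rewrite ((svalP Phi).1 _ _ _ _ h) ((svalP Psi).1 _ _ _ _ h); ring.
exists (bnorm (sval Phi) + bnorm (sval Psi)) => p.
apply: le_trans (nCD _ _) _; rewrite nCN.
have := bnorm_ub p (svalP Phi); have := bnorm_ub p (svalP Psi); nra.
Qed.

(** Weak* compactness of balls of the bidual: the pointwise limit inherits both linearity and the
    bound [M]. *)
Lemma bidual_limit (I : Type) (U : set_system I) (Phi : I -> bidual X) M :
  UltraFilter U -> (forall t, bnorm (sval (Phi t)) <= M) ->
  exists Psi : bidual X, forall p, ucv U (fun t => sval (Phi t) p) (sval Psi p).
Proof.
move=> UU hM.
have hb t p : nC (sval (Phi t) p) <= M * dnorm (sval p).
  apply: le_trans (bnorm_ub p (svalP (Phi t))) _.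
  by apply: ler_wpM2r => //; exact: dnorm_ge0 (svalP p).
have hc p := ucv_bounded UU (fun t => hb t p).
suff hl : is_bidual (fun p => ulim U (fun t => sval (Phi t) p)).
  by exists (exist _ _ hl) => p; exact: hc.
split=> [a p q r h|].
  apply: ulimE; apply: ucv_ext (ucv_lin a (hc p) (hc q)) => t.
  by rewrite ((svalP (Phi t)).1 _ _ _ _ h).
exists M => p; apply: (ucv_le (hc p)); apply: (@filterE _ U) => t /=.
exact: hb.
Qed.

(** Weak* lower semicontinuity of the norm, applied to differences. *)
Lemma bnorm_limit (I : Type) (U : set_system I) (Phi Psi : I -> bidual X)
    (Phi0 Psi0 : bidual X) c : UltraFilter U ->
  (forall p, ucv U (fun t => sval (Phi t) p) (sval Phi0 p)) ->
  (forall p, ucv U (fun t => sval (Psi t) p) (sval Psi0 p)) ->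
  (forall t, bnorm (bidual_sub (Phi t) (Psi t)) <= c) ->
  bnorm (bidual_sub Phi0 Psi0) <= c.
Proof.
move=> UU h1 h2 hc; apply: bnorm_le => p p1; rewrite /bidual_sub.
apply: (ucv_le (ucvB (h1 p) (h2 p))); apply: (@filterE _ U) => t /=.
have := bnorm_ub p (is_bidual_sub (Phi t) (Psi t)).
have := bnorm_ge0 (is_bidual_sub (Phi t) (Psi t)).
have := dnorm_ge0 (svalP p); have := hc t; rewrite /bidual_sub; nra.
Qed.

End Biduals.

(** * Weakly almost periodic functions and the action of ultrafilters *)

Section WeaklyAlmostPeriodic.
Variable R : realType.
Implicit Types (g h : R -> R[i]).

Lemma supnorm_ub (h : Cb R) r : nC (sval h r) <= supnorm (sval h).
Proof.
have [M hM] := (svalP h).1.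
by apply: (@le_sup_image R R setT (fun r => nC (sval h r)) M).
Qed.

Lemma supnorm_le h c : (forall r, nC (h r) <= c) -> supnorm h <= c.
Proof. by move=> hc; apply: (@sup_image_le R R setT) => //; exists 0. Qed.

Lemma is_Cb_shift g t : is_Cb g -> is_Cb (fun r => g (r + t)).
Proof.
move=> [[M hM] gc]; split; first by exists M.
move=> r; apply: (@continuous_comp _ _ _ (fun r => r + t) g); last exact: gc.
by apply: cvgD; [exact: cvg_id|exact: cvg_cst].
Qed.

Definition Cb_shift (g : Cb R) t : Cb R := exist _ _ (is_Cb_shift t (svalP g)).

Lemma is_Cb_dual_eval r : is_Cb_dual (fun h : Cb R => sval h r).
Proof.
split=> [a h1 h2 h3 -> //|]; exists 1 => h; rewrite mul1r; exact: supnorm_ub.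
Qed.

Definition Cb_eval r : Cb_dual R := exist _ _ (is_Cb_dual_eval r).

Lemma is_Cb_dual_shift (mu : Cb_dual R) s : is_Cb_dual (fun h : Cb R => sval mu (Cb_shift h s)).
Proof.
have [mlin [M hM]] := svalP mu.
split=> [a h1 h2 h3 e|]; first by apply: mlin => r /=; exact: e.
exists `|M| => h; apply: le_trans (hM _) _.
have h0 : 0 <= supnorm (sval (Cb_shift h s)).
  exact: le_trans (nC_ge0 _) (supnorm_ub (Cb_shift h s) 0).
have : supnorm (sval (Cb_shift h s)) <= supnorm (sval h).
  by apply: supnorm_le => r /=; exact: supnorm_ub.
have := ler_norm M; have := normr_ge0 M; nra.
Qed.

Definition Cb_dual_shift mu s : Cb_dual R := exist _ _ (is_Cb_dual_shift mu s).

Lemma in_W_weak_limit (g : Cb R) (U : set_system R) : UltraFilter U ->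
  in_W (sval g) ->
  exists h : Cb R, forall mu : Cb_dual R,
    ucv U (fun t => sval mu (Cb_shift g t)) (sval mu h).
Proof.
move=> UU [_]; rewrite compact_ultra => hc.
pose u : R -> Cb_weak R := Cb_shift g.
have [|h [_ hh]] := hc (u @ U) (ultra_fmap u UU).
  apply: (@filterE _ U) => t; apply: subset_closure; by exists t.
exists h => mu.
by have /initial_ptws_cvg /(_ mu) := hh.
Qed.

(* Translations are weakly continuous, so the orbit closure of a weak limit of
   translates of [g] stays in the orbit closure of [g]. *)
Lemma in_W_limit (g h : Cb R) (U : set_system R) : UltraFilter U ->
  in_W (sval g) ->
  (forall mu : Cb_dual R, ucv U (fun t => sval mu (Cb_shift g t)) (sval mu h)) ->
  in_W (sval h).
Proof.
move=> UU Wg gh; split; first exact: svalP.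
apply: (subclosed_compact _ Wg.2); first exact: closed_closure.
rewrite [X in _ `<=` X](closure_id _).1; last exact: closed_closure.
apply: closureS => k [s hk].
pose u : R -> Cb_weak R := fun t => Cb_shift (Cb_shift g t) s.
have cv : u @ U --> (k : Cb_weak R).
  apply/initial_ptws_cvg => mu; have := gh (Cb_dual_shift mu s).
  congr (ucv _ _ (sval mu _)); apply: sval_inj; by rewrite hk.
move=> B /cv UB; have [t Bt] := @filter_ex _ U _ _ UB.
exists (u t); split=> //; exists (s + t); apply/funext => r /=.
by rewrite addrA.
Qed.

End WeaklyAlmostPeriodic.

Section Action.
Variables (R : realType) (X : completeNormedModType R[i]).
Implicit Types (f h k : WW X) (p : dual X) (U V : set_system R).

Definition acts U h k := forall r p,
  ucv U (fun t => sval (sval h (r + t)) p) (sval (sval k r) p).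

Lemma WW_eq h k : (forall r p, sval (sval h r) p = sval (sval k r) p) -> h = k.
Proof.
move=> e; apply: sval_inj; apply/funext => r; apply: sval_inj.
by apply/funext => p.
Qed.

(** Boundedness and uniform continuity survive by lower semicontinuity of the norm. Weak almost
    periodicity survives because evaluations are functionals on [Cb], so the pointwise limit of a
    scalar function agrees with the weak limit of its translates. *)
Lemma acts_exists U h : UltraFilter U -> exists k, acts U h k.
Proof.
move=> UU; have [[[M hM] hu] hW] := svalP h.
have /choice [k hk] : forall r, exists Psi : bidual X, forall p,
    ucv U (fun t => sval (sval h (r + t)) p) (sval Psi p).
  by move=> r; apply: (@bidual_limit _ _ _ _ _ M) => t.
suff hkW : in_WW k by exists (exist _ k hkW) => r p; exact: hk.
split.
  split.
    exists M => r; apply: bnorm_le => p p1.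
    apply: (ucv_le (hk r p)); apply: (@filterE _ U) => t /=.
    apply: le_trans (bnorm_ub p (svalP _)) _.
    have := hM (r + t); have := dnorm_ge0 (svalP p).
    by have := bnorm_ge0 (svalP (sval h (r + t))); nra.
  move=> e e0; have [d d0 hd] := hu (e / 2) ltac:(lra).
  exists d => // r s rs; apply: (@le_lt_trans _ _ (e / 2)); last lra.
  apply: (bnorm_limit UU (hk r) (hk s)) => t; apply: ltW; apply: hd.
  by rewrite opprD addrACA subrr addr0.
move=> p; have gW := hW p.
pose g : Cb R := exist _ _ gW.1.
have [h' hh'] := @in_W_weak_limit _ g U UU gW.
suff -> : (fun r => sval (k r) p) = sval h' by exact: (@in_W_limit _ g h' U UU gW hh').
apply/funext => r; apply: (ucv_unique (hk r p)).
exact: (hh' (Cb_eval r)).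
Qed.

Definition act U h : WW X := xget h [set k | acts U h k].

Lemma actP U h : UltraFilter U -> acts U h (act U h).
Proof.
move=> UU; have [k hk] := acts_exists h UU; rewrite /act.
by case: xgetP => [y -> //|/(_ k)].
Qed.

(** For fixed [t], the inner limit of [h (r + t + s)] along [V] is the value of [act V h] at
    [r + t], so uniqueness of limits suffices. *)
Lemma act_fconv U V h : UltraFilter U -> UltraFilter V ->
  act (fconv U V) h = act U (act V h).
Proof.
move=> UU UV; have UUV := fconv_ultra UU UV.
apply: WW_eq => r p.
have h1 := actP h UUV r p.
have h2 := actP (act V h) UU r p.
set x := sval _ p in h1 *; set y := sval _ p in h2 *.
apply/eqP; rewrite -subr_eq0; apply/eqP/nC_eq0/eqP; rewrite eq_le nC_ge0 andbT.
apply/ler_addgt0Pl => e e0; rewrite addr0.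
have e30 : 0 < e / 3 by lra.
have [t [/= ht1 ht2]] := filter_ex (@filterI _ U _ _ _ (h1 _ e30) (h2 _ e30)).
have h3 := actP h UV (r + t) p.
have [s [/= hs1 hs2]] := filter_ex (@filterI _ V _ _ _ ht1 (h3 _ e30)).
move: hs1 hs2 ht2; rewrite addrA.
set a := sval _ p; set b := sval _ p => hs1 hs2 ht2.
have := nC_triangle a x y; have := nC_triangle b a y; rewrite (nCC x a); lra.
Qed.

(** Taken as the action of a principal ultrafilter, so that membership in [WW] comes from
    [acts_exists]. *)
Definition WW_shift h t : WW X := act (principal_filter t) h.

Lemma WW_shiftE h t r : sval (WW_shift h t) r = sval h (r + t).
Proof.
have UP := principal_filter_ultra t.
apply: sval_inj; apply/funext => p.
apply: (ucv_unique (actP h UP r p)) => e e0.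
by apply/principal_filterP => /=; rewrite subrr nC0.
Qed.

End Action.

(** * The duality with integrable functions *)

Section NullSets.
Context d (T : measurableType d) (R : realType) (mu : {measure set T -> \bar R}).
Import HBNNSimple.

(* The library integral is defined for all functions, as a difference of lower
   integrals, and null sets do not affect it even without measurability. *)
Lemma integral_setC_null (N : set T) (f : T -> \bar R) :
  measurable N -> mu N = 0%E ->
  (\int[mu]_x f x = \int[mu]_(x in ~` N) f x)%E.
Proof.
move=> mN N0.
suff ge0 (g : T -> \bar R) : (forall x, 0 <= g x)%E ->
    (\int[mu]_x g x = \int[mu]_(x in ~` N) g x)%E.
  rewrite integralE [RHS]integralE; congr (_ - _)%E; exact: ge0.
move=> g0; have mC : measurable (~` N) by exact: measurableC.
have gC0 x : (0 <= (g \_ (~` N)) x)%E by rewrite patchE; case: ifP.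
rewrite [RHS]integral_mkcond !ge0_integralTE//.
apply/eqP; rewrite eq_le; apply/andP; split.
  apply: ge_ereal_sup => _ [h hg <-].
  apply: ereal_sup_ubound; exists (proj_nnsfun h mC).
    move=> x; rewrite -mrestrict !patchE.
    by case: ifP => _ //; exact: hg.
  rewrite -!integralT_nnsfun (@ge0_negligible_integral _ _ _ _ setT N)//; last 2 first.
  - by apply/measurable_EFinP; exact: measurable_funP.
  - by move=> x _; rewrite lee_fin.
  rewrite [RHS](@ge0_negligible_integral _ _ _ _ setT N)//; last 2 first.
  - by apply/measurable_EFinP; exact: measurable_funP.
  - by move=> x _; rewrite lee_fin.
  apply: eq_integral => x; rewrite inE => -[_ Nx].
  by rewrite -mrestrict patchE mem_set.
apply: ge_ereal_sup => _ [h hg <-]; apply: ereal_sup_ubound; exists h => // x.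
apply: le_trans (hg x) _; rewrite patchE; case: ifP => // _; exact: g0.
Qed.

End NullSets.

Section SimpleFunctions.
Variables (R : realType) (X : completeNormedModType R[i]).

(** The preimage is split over the finitely many values of [s], so no measurable structure on
    [dual X] is involved. *)
Lemma measurable_simple_dual (s : R -> dual X) (phi : R -> dual X -> R) :
  simple_dual s ->
  (forall p, measurable_fun setT (phi ^~ p : measurableTypeR R -> R)) ->
  measurable_fun setT ((fun r => phi r (s r)) : measurableTypeR R -> R).
Proof.
move=> [fs ms] mphi _ B mB; rewrite setTI.
rewrite (_ : _ @^-1` B =
    \bigcup_(y in range s) (s @^-1` [set y] `&` (phi ^~ y) @^-1` B)); last first.
  apply/seteqP; split=> r /=; first by move=> Br; exists (s r) => //; exists r.
  by move=> [y _ [<-]].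
apply: fin_bigcup_measurable => // y _; apply: measurableI; first exact: ms.
by have := mphi y measurableT B mB; rewrite setTI.
Qed.

End SimpleFunctions.

Section DualityPairing.
Variables (R : realType) (X : completeNormedModType R[i]).
Local Notation mu := (@lebesgue_measure R).
Local Notation mR := (measurableTypeR R).
Implicit Types (g : L1d X) (h k : WW X).

(** [pairing] integrates real and imaginary parts separately; this abstraction treats both at
    once. *)
Definition real_part (c : R[i] -> R) :=
  (forall z w, c (z - w) = c z - c w) /\ forall z, `|c z| <= nC z.

Lemma real_part_Re : real_part (@complex.Re R).
Proof. by split=> [[a b] [a' b'] //|z]; exact: nC_Re. Qed.

Lemma real_part_Im : real_part (@complex.Im R).
Proof. by split=> [[a b] [a' b'] //|z]; exact: nC_Im. Qed.

Lemma continuous_real_part (c : R[i] -> R) h p : real_part c ->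
  continuous (fun r => c (sval (sval h r) p)).
Proof.
move=> [cB cn] r.
have /cvg_ucv hc : (fun r => sval (sval h r) p) @ nbhs r --> sval (sval h r) p.
  exact: ((svalP h).2 p).1.2.
apply/cvgrPdist_lt => e e0; apply: filterS (hc e e0) => r' /= hr.
by rewrite -cB; apply: le_lt_trans (cn _) _; rewrite nCC.
Qed.

Lemma dnorm_subr (p q : dual X) : `|dnorm (sval p) - dnorm (sval q)| <= dnorm (dual_sub p q).
Proof.
have half (a b : dual X) : dnorm (sval a) <= dnorm (dual_sub a b) + dnorm (sval b).
  apply: dnorm_le => x x1; rewrite -(subrK (sval b x) (sval a x)).
  apply: le_trans (nCD _ _) _.
  have := dnorm_ub x (svalP b); have := @dnorm_ub _ _ (dual_sub a b) x.
  have := @dnorm_ge0 _ _ (dual_sub a b); have := dnorm_ge0 (svalP b).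
  rewrite !dual_subE => h0 /(_ (svalP _)) h1 /(_ (svalP _)) h2 h3.
  move: h1 h2; rewrite -!dual_subE /dual_sub => h1 h2.
  by have := nX_ge0 x; nra.
have sym : dnorm (dual_sub q p) = dnorm (dual_sub p q).
  by rewrite /dnorm; congr sup; apply: eq_imagel => x _; rewrite /dual_sub nCC.
rewrite ler_norml; have := half p q; have := half q p; rewrite sym; lra.
Qed.

Lemma bidual_lipschitz (Phi : bidual X) (p q : dual X) :
  nC (sval Phi p - sval Phi q) <= bnorm (sval Phi) * dnorm (dual_sub p q).
Proof.
rewrite dual_subE; apply: le_trans _ (bnorm_ub _ (svalP Phi)).
by rewrite (is_bidual_lin _ _ _ (svalP Phi)) mulN1r addrC.
Qed.

Definition L1_approx g (N : set mR) (s : nat -> R -> dual X) :=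
  [/\ measurable N, mu N = 0%E, forall n, simple_dual (s n) &
  forall r, ~ N r -> (fun n => dnorm (dual_sub (s n r) (sval g r))) @ \oo --> (0 : R)].

Lemma L1_approx_exists g : exists N s, L1_approx g N s.
Proof.
have [[s [ss sg]] _] := svalP g; have [N [mN N0 sN]] := sg.
exists N, s; split=> // r Nr; apply: contrapT => h; apply: Nr; exact: sN.
Qed.

Section Approximation.
Variables (g : L1d X) (N : set mR) (s : nat -> R -> dual X).
Hypothesis gs : L1_approx g N s.
Let D := ~` N.

Let mD : measurable D.
Proof. by case: gs => mN _ _ _; exact: measurableC. Qed.

Lemma measurable_dnorm : measurable_fun D ((fun r => dnorm (sval (sval g r))) : mR -> R).
Proof.
have [mN N0 ss sg] := gs.
apply: (@measurable_fun_cvg _ mR R D (fun n r => dnorm (sval (s n r)))).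
  move=> n; apply: measurable_funTS.
  apply: (@measurable_simple_dual R X (s n) (fun _ p => dnorm (sval p)) (ss n)) => p.
  exact: measurable_cst.
move=> r Dr; apply/cvgrPdist_lt => e e0.
have /cvgrPdist_lt /(_ e e0) := sg r Dr.
apply: filterS => n /=; rewrite sub0r normrN distrC => hn.
apply: le_lt_trans (dnorm_subr _ _) _; exact: le_lt_trans (ler_norm _) hn.
Qed.

Lemma integrable_dnorm (M : R) :
  mu.-integrable D (fun r => (M * dnorm (sval (sval g r)))%:E).
Proof.
have [mN N0 ss sg] := gs.
have -> : (fun r => (M * dnorm (sval (sval g r)))%:E) =
   (fun r => M%:E * (dnorm (sval (sval g r)))%:E)%E by [].
apply: integrableZl => //; apply/integrableP; split.
  by apply/measurable_EFinP; exact: measurable_dnorm.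
have [_] := svalP g; rewrite (integral_setC_null _ mN N0).
apply: le_lt_trans; rewrite le_eqVlt; apply/orP; left; apply/eqP.
apply: eq_integral => r _ /=; rewrite ger0_norm//.
exact: dnorm_ge0 (svalP _).
Qed.

(** With [g] replaced by a simple function, only the continuous functions [sval (sval k r) p] at
    finitely many [p] occur; the bound on [k] carries measurability to the limit. *)
Lemma measurable_pairing_part (c : R[i] -> R) k : real_part c ->
  measurable_fun D ((fun r => c (sval (sval k r) (sval g r))) : mR -> R).
Proof.
move=> cP; have [cB cn] := cP; have [mN N0 ss sg] := gs.
have [[[M hM] _] _] := svalP k.
apply: (@measurable_fun_cvg _ mR R D (fun n r => c (sval (sval k r) (s n r)))).
  move=> n; apply: measurable_funTS.
  apply: (@measurable_simple_dual R X (s n) (fun r p => c (sval (sval k r) p)) (ss n)) => p.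
  by apply: continuous_measurable_fun; exact: continuous_real_part cP.
move=> r Dr; apply/cvgrPdist_lt => e e0.
have M0 : 0 <= M := le_trans (bnorm_ge0 (svalP (sval k r))) (hM r).
have d0 : 0 < e / (M + 1) by rewrite divr_gt0//; lra.
have /cvgrPdist_lt /(_ _ d0) := sg r Dr.
apply: filterS => n /=; rewrite sub0r normrN => hn.
rewrite -cB; apply: le_lt_trans (cn _) _; rewrite nCC.
apply: le_lt_trans (bidual_lipschitz _ _ _) _.
have := le_lt_trans (ler_norm _) hn; rewrite ltr_pdivlMr; last lra.
have dn : 0 <= dnorm (dual_sub (s n r) (sval g r)).
  by rewrite dual_subE; exact: dnorm_ge0 (svalP _).
have := hM r; nra.
Qed.

(** Dominated convergence with majorant [M * dnorm (sval (sval g r))]. Convergence is required only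
    at the values of the simple functions, which is all that can be arranged along a sequence; the
    common bound [M] extends it to [g r]. *)
Lemma pairing_part_cvg (c : R[i] -> R) (k_ : nat -> WW X) k (M : R) : real_part c ->
  (forall n r, bnorm (sval (sval (k_ n) r)) <= M) ->
  (forall r, bnorm (sval (sval k r)) <= M) ->
  (forall r m, ucv \oo (fun n => sval (sval (k_ n) r) (s m r)) (sval (sval k r) (s m r))) ->
  (fun n => Rintegral mu setT (fun r => c (sval (sval (k_ n) r) (sval g r)))) @ \oo -->
   Rintegral mu setT (fun r => c (sval (sval k r) (sval g r))).
Proof.
move=> cP hM hMk hk; have [cB cn] := cP; have [mN N0 ss sg] := gs.
have M0 : 0 <= M := le_trans (bnorm_ge0 (svalP (sval k 0))) (hMk 0).
pose F n r := (c (sval (sval (k_ n) r) (sval g r)))%:E.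
pose F0 r := (c (sval (sval k r) (sval g r)))%:E.
have [||||| iF _ cvF] := @dominated_convergence _ mR R mu D mD F F0
  (fun r => (M * dnorm (sval (sval g r)))%:E).
- by move=> n; apply/measurable_EFinP; exact: measurable_pairing_part.
- by apply/measurable_EFinP; exact: measurable_pairing_part.
- apply: aeW => r Dr; apply: cvg_EFin; first exact: nearW.
  apply/cvgrPdist_lt => e e0 /=.
  (* Replacing [g r] by [s m r] costs at most [e / 4] on each side, leaving [e / 2] for the
     convergence at [s m r]. *)
  have d0 : 0 < e / (4 * (M + 1)) by rewrite divr_gt0//; lra.
  have /cvgrPdist_lt /(_ _ d0) [m _ /(_ m (leqnn m)) /=] := sg r Dr.
  rewrite sub0r normrN => /(le_lt_trans (ler_norm _)) hm.
  have e20 : 0 < e / 2 by lra.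
  apply: filterS (hk r m _ e20) => n /= hn.
  rewrite -cB; apply: le_lt_trans (cn _) _; rewrite nCC.
  have dn : 0 <= dnorm (dual_sub (s m r) (sval g r)).
    by rewrite dual_subE; exact: dnorm_ge0 (svalP _).
  move: hm; rewrite ltr_pdivlMr; last lra.
  have b1 := le_trans (bidual_lipschitz (sval (k_ n) r) (s m r) (sval g r))
               (ler_wpM2r dn (hM n r)).
  have b2 := le_trans (bidual_lipschitz (sval k r) (s m r) (sval g r))
               (ler_wpM2r dn (hMk r)).
  move: b1 hn; set x := sval _ _; set y := sval _ _ => b1.
  move: b2; set z := sval _ _; set w := sval _ _ => b2 hn.
  have := nC_triangle x y w; have := nC_triangle z x w; rewrite (nCC y x); nra.
- exact: integrable_dnorm.
- apply: aeW => r n Dr; rewrite lee_fin; apply: le_trans (cn _) _.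
  apply: le_trans (bnorm_ub _ (svalP _)) _.
  by apply: ler_wpM2r => //; exact: dnorm_ge0 (svalP _).
rewrite /Rintegral (integral_setC_null _ mN N0) -/F0.
apply: fine_cvg; rewrite fineK; last exact: integrable_fin_num.
apply: cvg_trans cvF; apply: near_eq_cvg; apply: nearW => n /=.
by rewrite (integral_setC_null _ mN N0).
Qed.

End Approximation.

Lemma pairing_cvg g (N : set mR) s (k_ : nat -> WW X) k (M : R) : L1_approx g N s ->
  (forall n r, bnorm (sval (sval (k_ n) r)) <= M) ->
  (forall r, bnorm (sval (sval k r)) <= M) ->
  (forall r m, ucv \oo (fun n => sval (sval (k_ n) r) (s m r)) (sval (sval k r) (s m r))) ->
  ucv \oo (fun n => pairing (sval g) (sval (k_ n))) (pairing (sval g) (sval k)).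
Proof.
move=> gs hM hMk hk e e0.
have e20 : 0 < e / 2 by lra.
have /cvgrPdist_lt /(_ _ e20) h1 := pairing_part_cvg gs real_part_Re hM hMk hk.
have /cvgrPdist_lt /(_ _ e20) h2 := pairing_part_cvg gs real_part_Im hM hMk hk.
refine (filterSr (filterI h1 h2) _) => n /= []; rewrite /pairing.
move: (Rintegral _ _ _) (Rintegral _ _ _) (Rintegral _ _ _) (Rintegral _ _ _) => a b x y.
rewrite distrC => ha; rewrite distrC => hb; apply: le_lt_trans (nC_ReIm _) _ => /=.
by rewrite !(mul0r, mul1r, mulr0, add0r, addr0, subr0, sub0r, oppr0); lra.
Qed.

Lemma filter_finite (I : Type) (T : eqType) (F : set_system I) {FF : Filter F} (A : set T)
    (Q : T -> set I) : finite_set A -> (forall x, F (Q x)) ->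
  F [set t | forall x, A x -> Q x t].
Proof.
move=> /finite_seqP [l ->] FQ; elim: l => [|x l IH].
  by refine (filterSr filterT _) => t _ x.
refine (filterSr (filterI (FQ x) IH) _) => t [h1 h2] y /=.
by rewrite inE => /orP[/eqP ->|yl] //; exact: h2.
Qed.

Definition enum_rat (n : nat) : R := odflt 0 (omap ratr (unpickle n : option rat)).

Lemma enum_rat_near (x e : R) : 0 < e -> exists n : nat, `|x - enum_rat n| < e.
Proof.
move=> e0; have /rat_in_itvoo [q] : x - e < x + e by lra.
rewrite in_itv /= => /andP[q1 q2]; exists (pickle q); rewrite /enum_rat pickleK /=.
by rewrite ltr_norml; lra.
Qed.

(* An ultrafilter limit of integrals is not covered by dominated convergence.
   By equicontinuity, convergence of the translates at the rationals, tested on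
   the countably many values of the approximating simple functions, suffices, and
   this can be achieved along a sequence chosen in any member of [U]. *)
Lemma pairing_act g h (U : set_system R) : UltraFilter U ->
  ucv U (fun t => pairing (sval g) (sval (WW_shift h t))) (pairing (sval g) (sval (act U h))).
Proof.
move=> UU e e0; apply: contrapT => nU.
have {}nU := ultra_setC UU nU.
have [N [s gs]] := L1_approx_exists g; have [_ _ ss _] := gs.
have [[[M hM] hu] _] := svalP h.
pose k := act U h; have hk := actP h UU; rewrite -/k in hk nU.
pose q := enum_rat.
pose C n := [set t | forall m, (m <= n)%N -> forall j, (j <= n)%N -> forall p, range (s m) p ->
  nC (sval (sval h (q j + t)) p - sval (sval k (q j)) p) < n.+1%:R^-1].
have UC n : U (C n).
  have fin : finite_set [set m : nat | (m <= n)%N] by exact: finite_II n.+1.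
  apply: (filter_finite (A := [set m : nat | (m <= n)%N])
    (Q := fun m t => forall j, (j <= n)%N -> forall p, range (s m) p -> _)) => // m.
  apply: (filter_finite (A := [set m : nat | (m <= n)%N])
    (Q := fun j t => forall p, range (s m) p -> _)) => // j.
  apply: (filter_finite (A := range (s m)) (Q := fun p => _)) => [|p]; first exact: (ss m).1.
  by apply: hk; rewrite invr_gt0 ltr0n.
have /choice [t ht] : forall n, exists t, (~` [set t | nC (pairing (sval g) (sval (WW_shift h t)) -
    pairing (sval g) (sval k)) < e] `&` C n) t.
  by move=> n; exact: filter_ex (@filterI _ U _ _ _ nU (UC n)).
have hMk r : bnorm (sval (sval k r)) <= M.
  apply: bnorm_le => p p1; apply: (ucv_le (hk r p)); apply: (@filterE _ U) => t' /=.
  apply: le_trans (bnorm_ub p (svalP _)) _.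
  have := hM (r + t'); have := dnorm_ge0 (svalP p).
  by have := bnorm_ge0 (svalP (sval h (r + t'))); nra.
have hMt n r : bnorm (sval (sval (WW_shift h (t n)) r)) <= M by rewrite WW_shiftE.
suff hc r m : ucv \oo (fun n => sval (sval (WW_shift h (t n)) r) (s m r)) (sval (sval k r) (s m r)).
  have [n _ /(_ n (leqnn n)) /= hn] := pairing_cvg gs hMt hMk hc e0.
  by have [] := ht n.
move=> d d0; pose p := s m r; have dp := dnorm_ge0 (svalP p).
(* Moving from [r] to a rational costs at most [d / 4] for the translate and [d / 4] for [k]; the
   comparison at the rational gets [d / 2]. *)
have d1 : 0 < d / (4 * (dnorm (sval p) + 1)) by rewrite divr_gt0//; lra.
have [a a0 ha] := hu _ d1.
have [[_ /(_ _ d1) [b b0 hb]] _] := svalP k.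
have [j hj] := @enum_rat_near r (Num.min a b) ltac:(by rewrite lt_min a0).
rewrite -/(q j) lt_min in hj; have /andP[ja jb] := hj.
have d20 : 0 < d / 2 by lra.
have [n0 _ hn0] := near_infty_natSinv_lt (PosNum d20).
exists (maxn n0 (maxn m j)) => // n /=; rewrite !geq_max => /and3P[n0n mn jn].
rewrite WW_shiftE; have [_ /(_ m mn j jn p)] := ht n.
move=> /(_ ltac:(by exists r)) h1; have /= h2 := hn0 n n0n.
have h3 := ha (r + t n) (q j + t n); have h4 := hb (q j) r.
move: h3 h4; rewrite opprD addrACA subrr addr0 => /(_ ja) h3.
rewrite distrC => /(_ jb) h4.
have h5 := bnorm_ub p (is_bidual_sub (sval h (r + t n)) (sval h (q j + t n))).
have h6 := bnorm_ub p (is_bidual_sub (sval k (q j)) (sval k r)).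
have h7 : d / (4 * (dnorm (sval p) + 1)) * dnorm (sval p) <= d / 4.
  rewrite invfM mulrA -mulrA ler_piMr//; first lra.
  by rewrite mulrC ler_pdivrMr; lra.
have h8 := le_trans h5 (ler_wpM2r dp (ltW h3)).
have h9 := le_trans h6 (ler_wpM2r dp (ltW h4)).
move: h8 h9 h1; rewrite /bidual_sub.
set x1 := sval (sval h (r + t n)) p; set x2 := sval (sval h (q j + t n)) p.
set y1 := sval (sval k (q j)) p; set y2 := sval (sval k r) p => h8 h9 h1.
have := nC_triangle x2 x1 y2; have := nC_triangle y1 x2 y2.
move: (le_trans h8 h7) (le_trans h9 h7) (lt_trans h1 h2) => {}h8 {}h9 {}h1.
clear -h8 h9 h1 d0; lra.
Qed.

End DualityPairing.

(** * Separation by step functions and the closure of the translations *)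

Section Separation.
Variables (R : realType) (X : completeNormedModType R[i]).
Local Notation mu := (@lebesgue_measure R).
Local Notation mR := (measurableTypeR R).
Implicit Types (h k : WW X).

Lemma eq_of_Rintegrals (u v : R -> R) : continuous u -> continuous v ->
  (forall a b, a < b -> Rintegral mu `[a, b] u = Rintegral mu `[a, b] v) -> u =1 v.
Proof.
suff half (u' v' : R -> R) : continuous u' -> continuous v' ->
    (forall a b, a < b -> Rintegral mu `[a, b] u' = Rintegral mu `[a, b] v') ->
    forall x, u' x <= v' x.
  by move=> cu cv e x; apply/eqP; rewrite eq_le !half// => a b ab; rewrite e.
move=> cu cv e x; rewrite leNgt; apply/negP => vu.
(* Near [x] each function moves by less than a third of the gap, so a third of it remains on the
   whole interval. *)
have w0 : 0 < (u' x - v' x) / 3 by lra.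
have /cvgrPdist_lt /(_ _ w0) h1 := cu x; have /cvgrPdist_lt /(_ _ w0) h2 := cv x.
have h12 := @filterI _ _ (nbhs_filter x) _ _ h1 h2; have /nbhs_normP [d /= d0 hd] := h12.
have xd : x < x + d / 2 by lra.
have iw f : continuous f -> mu.-integrable `[x, x + d / 2] (EFin \o f).
  move=> cf; apply: continuous_compact_integrable; first exact: segment_compact.
  by apply: continuous_subspaceT.
have := e _ _ xd; apply/eqP; rewrite gt_eqF// -subr_gt0 -RintegralB//; [|exact: iw..].
apply: (@lt_le_trans _ _ (Rintegral mu `[x, x + d / 2] (fun=> (u' x - v' x) / 3))).
  rewrite Rintegral_cst// [X in fine X](_ : _ = (d / 2)%:E) /= ?mulr_gt0//; first lra.
  have -> := @lebesgue_measure_itv R (Interval (BLeft x) (BRight (x + d / 2))).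
  rewrite /= lte_fin xd -EFinB.
  by rewrite addrAC subrr add0r.
apply: le_Rintegral => //.
- by apply: iw => y; exact: cvg_cst.
- by apply: (@iw (fun r => u' r - v' r)) => y; apply: cvgB; [exact: cu|exact: cv].
move=> y /=; rewrite in_itv /= => /andP[y1 y2].
have [|h3 h4] := hd y; first by rewrite /ball_ /= ltr_distlC; apply/andP; split; lra.
by move: h3 h4; rewrite /= !ltr_norml; lra.
Qed.

Variables (p : dual X) (a b : R).

Let step (r : R) : dual X := if r \in `[a, b]%R then p else dual_zero X.

Let is_L1_step : is_L1_dual step.
Proof.
have stepE r : (dnorm (sval (step r)))%:E =
    ((cst (dnorm (sval p))%:E) \_ (`[a, b]%classic : set R)) r.
  rewrite /step patchE mem_setE; case: ifP => // _; by rewrite dnorm_zero.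
split; last first.
  under eq_integral do rewrite stepE.
  rewrite -integral_mkcond integral_cst//=.
  have -> := @lebesgue_measure_itv R (Interval (BLeft a) (BRight b)); rewrite /=.
  by case: ifP; rewrite ?mule0 ?ltry// -EFinB -EFinM ltry.
exists (fun=> step); split; last first.
  apply: aeW => r.
  have -> : (fun=> dnorm (dual_sub (step r) (step r))) = (fun=> (0 : R)) :> (nat -> R).
    apply/funext => _; apply/eqP; rewrite eq_le; apply/andP; split.
      by apply: dnorm_le => x _; rewrite /dual_sub subrr nC0.
    by rewrite dual_subE; exact: dnorm_ge0 (svalP _).
  exact: cvg_cst.
move=> _; split.
  apply: (@sub_finite_set _ _ [set p; dual_zero X]); last exact: finite_set2.
  by move=> _ [r _ <-]; rewrite /step; case: ifP; [left|right].
move=> y.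
have -> : step @^-1` [set y] = (`[a, b]%classic `&` [set r | p = y]) `|`
    (~` `[a, b]%classic `&` [set r | dual_zero X = y]).
  apply/seteqP; split=> r; rewrite /step /=.
    by case: ifP => rab e; [left|right]; split.
  by move=> [[rab <-]|[rab <-]]; [rewrite ifT|rewrite ifF//; exact/negbTE/negP].
have mc (Q : Prop) : measurable ([set r | Q] : set mR).
  have [q|q] := pselect Q.
    by rewrite (_ : [set r | Q] = setT)//; apply/seteqP; split.
  by rewrite (_ : [set r | Q] = set0)//; apply/seteqP; split.
apply: measurableU; (apply: measurableI; last exact: mc) => //.
by apply: measurableC; exact: measurable_itv.
Qed.

Definition L1_step : L1d X := exist _ _ is_L1_step.

Lemma Rintegral_L1_step (c : R[i] -> R) h : c 0 = 0 ->
  Rintegral mu setT (fun r => c (sval (sval h r) (sval L1_step r))) =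
  Rintegral mu `[a, b] (fun r => c (sval (sval h r) p)).
Proof.
move=> c0; rewrite [RHS]Rintegral_mkcond; apply: eq_Rintegral => r _.
rewrite patchE mem_setE /= /step; case: ifP => // _.
by rewrite is_bidual0//; exact: svalP.
Qed.

End Separation.

Section OperatorClosure.
Variables (R : realType) (X : completeNormedModType R[i]).
Implicit Types (h k : WW X) (T : OpsW X).

(** Testing with [p] times interval indicators gives all interval integrals of continuous scalar
    functions. Hence limits in [OpsW] are unique. *)
Lemma pairing_inj h k :
  (forall g : L1d X, pairing (sval g) (sval h) = pairing (sval g) (sval k)) -> h = k.
Proof.
move=> e; apply: WW_eq => r p.
have hRe : (fun r => complex.Re (sval (sval h r) p)) =1 (fun r => complex.Re (sval (sval k r) p)).
  apply: eq_of_Rintegrals => [||a b ab]; [exact: continuous_real_part (real_part_Re R)..|].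
  have := congr1 (@complex.Re R) (e (L1_step p a b)); rewrite /pairing /=.
  by rewrite !(mul0r, mul1r, mulr0, addr0, subr0)
    !(@Rintegral_L1_step _ _ _ _ _ (@complex.Re R)).
have hIm : (fun r => complex.Im (sval (sval h r) p)) =1 (fun r => complex.Im (sval (sval k r) p)).
  apply: eq_of_Rintegrals => [||a b ab]; [exact: continuous_real_part (real_part_Im R)..|].
  have := congr1 (@complex.Im R) (e (L1_step p a b)); rewrite /pairing /=.
  by rewrite !(mul0r, mul1r, mulr0, add0r, addr0, subr0)
    !(@Rintegral_L1_step _ _ _ _ _ (@complex.Im R)).
by apply/eqP; rewrite eq_complex; apply/andP; split; apply/eqP; [exact: hRe|exact: hIm].
Qed.

Lemma act_cvg (U : set_system R) (T : OpsW X) : UltraFilter U ->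
  ((fun t => ((fun h => WW_shift h t) : OpsW X)) @ U --> T) <-> T = act U.
Proof.
move=> UU; split=> [|->].
  move=> /initial_ptws_cvg cT; apply/funext => h; apply: pairing_inj => g.
  exact: (ucv_unique (cT (h, g)) (pairing_act g h UU)).
apply/initial_ptws_cvg => -[h g]; exact: pairing_act.
Qed.

Lemma Tcl_act (U : set_system R) : UltraFilter U -> Tcl (act U : OpsW X).
Proof.
move=> UU B; have /(_ erefl) cU := (act_cvg (act U) UU).2.
move=> /cU UB; have [t Bt] := @filter_ex _ U _ _ UB.
exists ((fun h => WW_shift h t)); split=> //; exists t => h; apply/funext => r; exact: WW_shiftE.
Qed.

Lemma Tcl_ultra T : Tcl T -> exists2 U : set_system R, UltraFilter U & T = act U.
Proof.
move=> TT; pose tr : R -> OpsW X := fun t => (fun h => WW_shift h t).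
(* Neighbourhoods of [T] pulled back to the translation parameter; none is empty because [T] is
   adherent to the translations. *)
have PF : ProperFilter (filter_from (nbhs T) (fun B => tr @^-1` B)).
  apply: filter_from_proper.
    apply: filter_from_filter; first by exists setT; exact: filterT.
    by move=> A B TA TB; exists (A `&` B) => //; exact: filterI.
  move=> B /TT [V [[t hV] BV]]; exists t; rewrite /= /tr.
  suff -> : (fun h => WW_shift h t) = V :> OpsW X by [].
  apply/funext => h; apply: sval_inj; rewrite hV; apply/funext => r; exact: WW_shiftE.
have [U [UU sU]] := ultraFilterLemma PF.
exists U => //; apply/act_cvg => // B TB; apply: sU; by exists B.
Qed.

End OperatorClosure.

(** * Reversibility *)

Section Minimality.
Variables (R : realType) (X : completeNormedModType R[i]).
Implicit Types (h k : WW X).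

(* [A] is a member of [F0] iff all its translates are members of [V], so [F0]
   represents the closure of the left ideal generated by [V]. *)
Lemma idempotent_in_left_ideal (V : set_system R) : UltraFilter V ->
  exists Q W, [/\ UltraFilter Q, UltraFilter W, fconv Q Q = Q & Q = fconv W V].
Proof.
move=> UV.
pose F0 := [set A | forall t, V [set s | A (t + s)]].
have PF0 : ProperFilter F0.
  split; first by move=> /(_ 0) h; have [] := @filter_ex _ V _ _ h.
  split.
  - by move=> t; apply: (@filterE _ V).
  - by move=> A B hA hB t; refine (filterSr (F := V) (@filterI _ V _ _ _ (hA t) (hB t)) _).
  - by move=> A B AB hA t; refine (filterSr (F := V) (hA t) _) => s; exact: AB.
have iF0 : F0 `<=` fconv F0 F0.
  move=> A hA t; apply: (@filterE _ V) => s r.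
  by refine (filterSr (F := V) (hA (t + s + r)) _) => u /=; rewrite !addrA.
have [Q [UQ sQ iQ]] := idempotent_ultrafilter PF0 iF0.
(* [fconv W V] contains [Q] as soon as [W] contains [B A] for every [A] in [Q]. No [B A] is empty:
   otherwise the complement of [A] would lie in [F0], hence in [Q]. *)
pose B (A : set R) := [set t | V [set s | A (t + s)]].
have [|_ [A QA <-]|_ _ [A QA <-] [A' QA' <-]|W [UW BW]] := @fip_ultra R (B @` Q).
- by exists (B setT), setT => //; exact: filterT.
- apply/set0P/eqP => BA0; have : F0 (~` A).
    move=> t; apply: (ultra_setC UV) => ht.
    by have : set0 t by rewrite -BA0.
  by move=> /sQ QnA; have [x []] := filter_ex (filterI QA QnA).
- exists (B (A `&` A')); first by exists (A `&` A') => //; exact: filterI.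
  by move=> t ht; split; refine (filterSr (F := V) ht _) => s [].
exists Q, W; split=> //.
apply/esym; apply: (max_filter (UltraFilter := UQ)).
  by have := fconv_ultra UW UV; case.
by move=> A QA; apply: BW; exists A.
Qed.

(* If [Q] is an idempotent in the left ideal generated by [U P], then [P Q] is an
   idempotent below [P], hence equal to [P]. *)
Lemma minimal_idempotent_reversible (P : OpsW X) (f : WW X) (U : set_system R) :
  minimal_idempotent P -> WW_a P f -> UltraFilter U ->
  exists2 W : set_system R, UltraFilter W & act W (act U f) = f.
Proof.
move=> [TP [iP minP]] [f' ff'] UU.
have Pf : P f = f by rewrite ff' iP.
have [p Up Pp] := Tcl_ultra TP.
have Uup := fconv_ultra UU Up.
have [Q [V [UQ UV iQ eQ]]] := idempotent_in_left_ideal Uup.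
have QE h : act Q h = act V (act U (P h)) by rewrite eQ !act_fconv// -Pp.
have QP h : act Q (P h) = act Q h by rewrite !QE iP.
have QQ h : act Q (act Q h) = act Q h by rewrite -act_fconv// iQ.
have UpQ := fconv_ultra Up UQ; have UpV := fconv_ultra Up UV.
(* Minimality will give [P (act Q f) = f]; expanding [act Q] by [QE] turns the left side into
   [act (fconv p V) (act U f)]. *)
exists (fconv p V) => //.
have pQE h : act (fconv p Q) h = P (act Q h) by rewrite act_fconv// -Pp.
have iPQ : Defs.idempotent_op (act (fconv p Q) : OpsW X).
  by move=> h; rewrite !pQE QP QQ.
have PPQ h : P (act (fconv p Q) h) = act (fconv p Q) h by rewrite pQE iP.
have := minP _ (Tcl_act UpQ) iPQ PPQ f.
by rewrite Pf pQE QE Pf act_fconv// -Pp.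
Qed.

End Minimality.

(** * Scalar orbits *)

Lemma filter_seq (I : Type) (T : eqType) (F : set_system I) {FF : Filter F} (l : seq T)
    (Q : T -> set I) : (forall x, F (Q x)) -> F [set t | forall x, x \in l -> Q x t].
Proof. by move=> FQ; apply: (filter_finite (A := [set` l])) => //; exact: finite_seq. Qed.

Section Scalar.
Variables (R : realType) (g : Cb R).
Hypothesis gW : in_W (sval g).
Hypothesis gu : forall e : R, 0 < e -> exists2 d : R, 0 < d &
  forall r s : R, `|r - s| < d -> nC (sval g r - sval g s) < e.

Let q := @enum_rat R.

(** One index bounds both the number of rational translates and the tolerance, so negating a claim
    over all [n] yields a sequence of pairs of points. *)
Definition close_translates n a b :=
  forall j, (j <= n)%N -> nC (sval g (a + q j) - sval g (b + q j)) < n.+1%:R^-1.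

(* If the conclusion failed along points [a n], [b n], an ultrafilter limit of
   [h |-> h (a n) - h (b n)] would be a functional in the dual of the bounded
   continuous functions vanishing on all translates of [g] but not on their weak
   limit [y]. *)
Lemma weak_limit_equicontinuous (U : set_system R) (y : R -> R[i]) (e : R) :
  UltraFilter U -> (forall r, ucv U (fun t => sval g (r + t)) (y r)) -> 0 < e ->
  exists n, forall a b, close_translates n a b -> nC (y a - y b) <= e.
Proof.
move=> UU gy e0; apply: contrapT => /forallNP nh.
have /choice [ab hab] : forall n, exists ab : R * R, close_translates n ab.1 ab.2 /\
    e < nC (y ab.1 - y ab.2).
  move=> n; have /existsNP [a /existsNP [b /not_implyP [h1 h2]]] := nh n.
  by exists (a, b); split=> //=; rewrite ltNge; apply/negP.
have [N [UN sN]] := ultraFilterLemma (F := \oo : set_system nat) _.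
have [h hh] := in_W_weak_limit UU gW.
have hy r : sval h r = y r by exact: (ucv_unique (hh (Cb_eval r)) (gy r)).
have ev_bound (k : Cb R) n : nC (sval k (ab n).1 - sval k (ab n).2) <= 2 * supnorm (sval k).
  apply: le_trans (nCD _ _) _; rewrite nCN.
  by have := supnorm_ub k (ab n).1; have := supnorm_ub k (ab n).2; lra.
have cv (k : Cb R) := ucv_bounded UN (ev_bound k).
have hmu : is_Cb_dual (fun k : Cb R => ulim N (fun n => sval k (ab n).1 - sval k (ab n).2)).
  split=> [a h1 h2 h3 h123|].
    apply: ulimE; apply: ucv_ext (ucv_lin a (cv h1) (cv h2)) => n.
    by rewrite !h123; ring.
  exists 2 => k; apply: (ucv_le (cv k)); apply: (@filterE _ N) => n; exact: ev_bound.
have := hh (exist _ _ hmu); set m := sval _ h => hm.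
have m0 : m = 0.
  apply: (ucv_unique hm); apply: ucv_ext (ucv_cst (F := U) (0 : R[i])) => t.
  apply/esym/ulimE => d d0 /=.
  (* On the translate by [t] the functional vanishes: [t] is near some rational [q j], and for large
     [n] the values at [ab n] shifted by [q j] nearly agree. *)
  have [c c0 hc] := gu (e := d / 3) ltac:(lra).
  have [j hj] := enum_rat_near t c0.
  have d30 : 0 < d / 3 by lra.
  have [n0 _ hn0] := near_infty_natSinv_lt (PosNum d30).
  have : (\oo : set_system nat) [set n | (maxn n0 j <= n)%N] by exists (maxn n0 j).
  move=> /sN hN; refine (filterSr (F := N) hN _) => n /=; rewrite geq_max => /andP[n0n jn].
  rewrite subr0; have /= h1 := hn0 n n0n; have [/(_ j jn) h2 _] := hab n.
  move: (ab n) h2 => [a b] /= h2.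
  have h3 := hc (a + t) (a + q j); have h4 := hc (b + q j) (b + t).
  move: h3 h4; rewrite !opprD !(addrACA _ t) !(addrACA _ (q j)) !subrr !add0r.
  move=> /(_ hj) h3; rewrite distrC => /(_ hj) h4.
  have := nC_triangle (sval g (a + q j)) (sval g (a + t)) (sval g (b + t)).
  have := nC_triangle (sval g (b + q j)) (sval g (a + q j)) (sval g (b + t)).
  move: (lt_trans h2 h1) => {}h2; clear -h2 h3 h4; lra.
have : e <= nC m.
  apply: (ucv_ge (cv h)); apply: (@filterE _ N) => n /=.
  by rewrite !hy; apply: ltW; have [] := hab n.
by rewrite m0 nC0; lra.
Qed.

(* Openness in the topology of pointwise convergence of the translates of [g]. *)
Definition translate_open (A : set R) := forall t, A t -> exists (l : seq R) (d : R),
  0 < d /\ forall s, (forall r, r \in l -> nC (sval g (r + s) - sval g (r + t)) < d) -> A s.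

Lemma translate_openI A B : translate_open A -> translate_open B -> translate_open (A `&` B).
Proof.
move=> oA oB t [/oA [l [d [d0 hA]]] /oB [l' [d' [d'0 hB]]]].
exists (l ++ l')%SEQ, (Num.min d d'); split=> [|s hs]; first by rewrite lt_min d0.
split; [apply: hA|apply: hB] => r rl.
  by have := hs r; rewrite mem_cat rl lt_min => /(_ isT)/andP[].
by have := hs r; rewrite mem_cat rl orbT lt_min => /(_ isT)/andP[].
Qed.

Lemma translate_open_gt a b (e : R) :
  translate_open [set t | e < nC (sval g (a + t) - sval g (b + t))].
Proof.
move=> t /= ht; exists [:: a; b], ((nC (sval g (a + t) - sval g (b + t)) - e) / 2).
split=> [|s hs]; first lra.
have := hs a; have := hs b; rewrite !inE !eqxx orbT => /(_ isT) + /(_ isT).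
move: (sval g (a + s)) (sval g (a + t)) (sval g (b + s)) (sval g (b + t)) ht => x y z w.
move=> ht h1 h2; have := nC_triangle x y w; have := nC_triangle z x w.
by rewrite (nCC y x) /=; lra.
Qed.

Lemma translate_open_near (L : seq R) t0 (e : R) : 0 < e ->
  translate_open [set t | forall a, a \in L -> nC (sval g (a + t) - sval g (a + t0)) < e].
Proof.
move=> e0; elim: L => [|b L IH].
  by move=> t _; exists [::], 1; split=> // s _ a; rewrite in_nil.
rewrite (_ : mkset _ = [set t | nC (sval g (b + t) - sval g (b + t0)) < e] `&`
    [set t | forall a, a \in L -> nC (sval g (a + t) - sval g (a + t0)) < e]).
  apply: translate_openI => // t /= ht.
  exists [:: b], (e - nC (sval g (b + t) - sval g (b + t0))); split=> [|s hs]; first lra.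
  have := hs b; rewrite inE eqxx => /(_ isT).
  by have := nC_triangle (sval g (b + t)) (sval g (b + s)) (sval g (b + t0)); lra.
apply/seteqP; split=> t /=.
  by move=> h; split=> [|a aL]; apply: h; rewrite inE ?eqxx ?aL ?orbT.
by move=> [h1 h2] a; rewrite inE => /orP[/eqP ->|/h2].
Qed.

(* Baire category: otherwise nested nonempty open sets, hence an ultrafilter, would
   violate [weak_limit_equicontinuous]. *)
Lemma equicontinuous_open_set (e : R) : 0 < e -> exists n (A : set R),
  [/\ translate_open A, A !=set0 & forall t a b, A t -> close_translates n a b ->
    nC (sval g (a + t) - sval g (b + t)) <= e].
Proof.
move=> e0; apply: contrapT => nh.
pose state := {A : set R | translate_open A /\ A !=set0}.
have step (x : nat * state) : exists B : state, sval B `<=` sval x.2 /\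
    exists a b, close_translates x.1 a b /\
    sval B `<=` [set t | e < nC (sval g (a + t) - sval g (b + t))].
  case: x => n [A [oA A0]] /=; apply: contrapT => nB; apply: nh; exists n, A; split=> //.
  move=> t a b At cab; rewrite leNgt; apply/negP => lt_e; apply: nB.
  have oB := translate_openI oA (@translate_open_gt a b e).
  exists (exist _ _ (conj oB (ex_intro _ t (conj At lt_e)))) => /=.
  by split=> [s []//|]; exists a, b; split=> // s [].
have /choice [nxt hnxt] := step.
have oT : translate_open setT /\ (setT : set R) !=set0.
  by split; [move=> t _; exists [::], 1|exists 0].
pose A_ := fix A_ n : state := if n is m.+1 then nxt (m, A_ m) else exist _ setT oT.
have decr m n : (m <= n)%N -> sval (A_ n) `<=` sval (A_ m).
  elim: n => [|n IH]; first by rewrite leqn0 => /eqP ->.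
  rewrite leq_eqVlt => /orP[/eqP -> //|/IH h]; apply: subset_trans h.
  exact: (hnxt (n, A_ n)).1.
have [|_ [n _ <-]|_ _ [n _ <-] [m _ <-]|U [UU AU]] := @fip_ultra R (range (fun n => sval (A_ n))).
- by exists (sval (A_ 0)), 0%N.
- exact: (svalP (A_ n)).2.
- exists (sval (A_ (maxn n m))); first by exists (maxn n m).
  by move=> t ht; split; apply: decr ht; rewrite ?leq_maxl ?leq_maxr.
have [M hM] := (svalP g).1.
have cv r := ucv_bounded UU (fun t => hM (r + t)).
(* The strict inequality defining the sets becomes [e <=] in the limit, so equicontinuity is invoked
   at [e / 2] for a contradiction. *)
have [n hn] := weak_limit_equicontinuous UU cv (e := e / 2) ltac:(lra).
have [_ [a [b [cab hB]]]] := hnxt (n, A_ n).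
have := hn a b cab.
have : e <= nC (ulim U (fun t => sval g (a + t)) - ulim U (fun t => sval g (b + t))).
  apply: (ucv_ge (ucvB (cv a) (cv b))).
  have UA : U (sval (A_ n.+1)) by apply: AU; exists n.+1.
  by refine (filterSr (F := U) UA _) => t /hB /= /ltW.
lra.
Qed.

(** By boundedness, finitely many points [b] meet every class of [close_translates n]. On the
    equicontinuous open set, agreement with [t0] at these [b] therefore controls all [a], at the
    cost of three errors [e / 3]. *)
Lemma stable_translate (e : R) : 0 < e -> exists t0 (l : seq R) (d : R), 0 < d /\
  forall t, (forall r, r \in l -> nC (sval g (r + t) - sval g (r + t0)) < d) ->
  forall a, nC (sval g (a + t) - sval g (a + t0)) <= e.
Proof.
move=> e0; have e30 : 0 < e / 3 by lra.
have [n [A [oA [t0 At0] hA]]] := equicontinuous_open_set e30.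
have [M hM] := (svalP g).1.
have [V UV|L hL] := @ultra_finite_cover R (fun b a => close_translates n a b).
  have cv j := ucv_bounded UV (fun t => hM (t + q j)).
  pose c : R := n.+1%:R^-1; have c0 : 0 < c by rewrite invr_gt0.
  have c20 : 0 < c / 2 by lra.
  have fin : finite_set [set j : nat | (j <= n)%N] by exact: finite_II n.+1.
  have FV : Filter V := @filter_filter _ _ (@ultra_proper _ _ UV).
  have VC := @filter_finite R nat V FV _ (fun j => [set t |
    nC (sval g (t + q j) - ulim V (fun t => sval g (t + q j))) < c / 2]) fin (fun j => cv j _ c20).
  have [b hb] := filter_ex VC; exists b; refine (filterSr (F := V) VC _) => a ha j jn.
  have := ha j jn; have /= := hb j jn; rewrite -/c.
  move: (sval g (b + _)) (sval g (a + _)) (ulim V _) => x y z h1 /= h2.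
  by have := nC_triangle z y x; rewrite (nCC z x); lra.
have oB := translate_openI oA (@translate_open_near L t0 _ e30).
have [|l [d [d0 hd]]] := oB t0.
  by split=> // a _; rewrite subrr nC0.
exists t0, l, d; split=> // t ht a.
have [At hLt] := hd t ht; have [b bL cab] := hL a.
have h1 := hA t a b At cab; have h2 := hA t0 a b At0 cab; have /= h3 := hLt b bL.
move: h1 h2 h3; move: (sval g (a + t)) (sval g (b + t)) (sval g (a + t0)) (sval g (b + t0)).
move=> x y z w h1 h2 h3; have := nC_triangle y x z; have := nC_triangle w y z.
by rewrite (nCC w z); lra.
Qed.

End Scalar.

Section ScalarCauchy.
Variables (R : realType) (X : completeNormedModType R[i]).

Definition reversible (f : WW X) := forall U : set_system R, UltraFilter U ->
  exists2 W : set_system R, UltraFilter W & act W (act U f) = f.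

Lemma reversible_scalar_cauchy (f : WW X) p (U : set_system R) (e : R) :
  reversible f -> UltraFilter U -> 0 < e ->
  exists2 A, U A & forall t s r, A t -> A s ->
    nC (sval (sval f (r + t)) p - sval (sval f (r + s)) p) <= e.
Proof.
move=> rf UU e0; have [[_ fu] fW] := svalP f.
pose g : Cb R := exist _ _ (fW p).1.
have gu (c : R) : 0 < c -> exists2 d : R, 0 < d &
    forall r s : R, `|r - s| < d -> nC (sval g r - sval g s) < c.
  move=> c0; have dp := dnorm_ge0 (svalP p).
  have c10 : 0 < c / (dnorm (sval p) + 1) by rewrite divr_gt0//; lra.
  have [d d0 hd] := fu _ c10; exists d => // r s rs.
  apply: le_lt_trans (bnorm_ub p (is_bidual_sub (sval f r) (sval f s))) _.
  have := hd r s rs; rewrite ltr_pdivlMr; last lra.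
  have := bnorm_ge0 (is_bidual_sub (sval f r) (sval f s)); nra.
have e20 : 0 < e / 2 by lra.
have [t0 [l [d [d0 hd]]]] := stable_translate (fW p : in_W (sval g)) gu e20.
have [W UW Wf] := rf U UU.
have d20 : 0 < d / 2 by lra.
have hW := actP (act U f) UW; rewrite Wf in hW.
have FW : Filter W := @filter_filter _ _ (@ultra_proper _ _ UW).
have FU : Filter U := @filter_filter _ _ (@ultra_proper _ _ UU).
(* Since [act W] returns [act U f] to [f], some [s] makes [act U f] shifted by [t0 + s] agree with
   [g] shifted by [t0] within [d / 2] on [l]. Translates along [U] then supply the other [d / 2]. *)
have [s hs] := filter_ex (@filter_seq _ _ W FW l _ (fun r => hW (r + t0) p _ d20)).
have hU := actP f UU.
have UB := @filter_seq _ _ U FU l _ (fun r => hU (r + t0 + s) p _ d20).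
have near t : (forall x, x \in l -> nC (sval (sval f (x + t0 + s + t)) p -
    sval (sval (act U f) (x + t0 + s)) p) < d / 2) ->
    forall a, nC (sval g (a + (t0 + s + t)) - sval g (a + t0)) <= e / 2.
  move=> ht; apply: hd => r rl; have := ht r rl; have /= := hs r rl.
  rewrite /= !addrA; set x := sval (sval f _) p; set y := sval _ p; set z := sval _ p => h1 h2.
  by have := nC_triangle y z x; lra.
refine (ex_intro2 _ _ _ UB _).
move=> t u r /near ht /near hu.
(* The estimate holds at every point, so the auxiliary shift [t0 + s] is undone by a change of
   variable. *)
have /= := ht (r - (t0 + s)); have /= := hu (r - (t0 + s)).
have sh (v : R) : r - (t0 + s) + (t0 + s + v) = r + v by ring.
rewrite !sh; set z := sval _ p; set y := sval _ p; set x := sval _ p => h1 h2.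
by have := nC_triangle y x z; rewrite (nCC y z); lra.
Qed.

End ScalarCauchy.

(** * Joint continuity and almost periodicity *)

Section JointContinuity.
Variables (R : realType) (X : completeNormedModType R[i]).

Lemma banach_alaoglu (F : set_system (BXw X)) : UltraFilter F ->
  exists b : BXw X, F --> b.
Proof.
move=> UF.
have bd (x : X) (b : BX X) : nC (sval (sval b) x) <= nX x.
  apply: le_trans (dnorm_ub x (svalP (sval b))) _.
  have b1 := svalP b; rewrite /= in b1.
  by have := nX_ge0 x; nra.
pose phi x := ulim F (fun b : BX X => sval (sval b) x).
have cv x : ucv F (fun b : BX X => sval (sval b) x) (phi x) := ucv_bounded UF (bd x).
have phi_le x : nC (phi x) <= nX x.
  by apply: (ucv_le (cv x)); apply: (@filterE _ F) => b; exact: bd.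
have lin a x y : phi (a *: x + y) = a * phi x + phi y.
  apply: (ucv_unique (cv _)); apply: ucv_ext (ucv_lin a (cv x) (cv y)) => b.
  by rewrite (svalP (sval b)).1.
have dphi : is_dual phi.
  split=> // x; apply/cvg_ucv => e e0; apply/nbhs_normP; exists e%:C%C; first by rewrite /= ltcR.
  move=> y; rewrite /ball_ /= distrC nXE ltcR => h.
  have -> : phi y - phi x = phi (-1 *: x + y) by rewrite lin; ring.
  by rewrite scaleN1r addrC; exact: le_lt_trans (phi_le _) h.
have b1 : dnorm phi <= 1 by apply: dnorm_le => x; exact: le_trans.
pose p : dual X := exist _ phi dphi.
exists (exist _ p b1 : BX X).
suff : (fun b : BXw X => b) @ F --> (exist _ p b1 : BXw X) by [].
by apply/initial_ptws_cvg => x; exact: cv.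
Qed.

Let Tcl_shift t : Tcl ((fun h => WW_shift h t) : OpsW X).
Proof. exact: (Tcl_act (principal_filter_ultra t)). Qed.

Definition totally_bounded_dual (f : WW X) := forall e : R, 0 < e ->
  exists L : seq (BX X), forall b : BX X, exists2 b0, b0 \in L &
    forall r, nC (sval (sval f r) (sval b) - sval (sval f r) (sval b0)) <= e.

(** Each bad functional [b] gets a bad point [a b], encoded as an operator [V b]. Along the
    ultrafilter, [(b, V b)] and [(b0, V b)] have the same limit, so joint continuity makes the
    difference at the bad points small. *)
Lemma joint_continuity_totally_bounded (f : WW X) (s : R) :
  continuous (Fjoint f s) -> totally_bounded_dual f.
Proof.
move=> cF e e0; apply: (@ultra_finite_cover (BX X)) => F UF.
have [b0 Fb0] := @banach_alaoglu F UF; exists b0; apply: contrapT => nD.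
have {}nD := ultra_setC UF nD.
have /choice [a ha] : forall b : BX X, exists a : R,
    (~ forall r, nC (sval (sval f r) (sval b) - sval (sval f r) (sval b0)) <= e) ->
    e < nC (sval (sval f a) (sval b) - sval (sval f a) (sval b0)).
  move=> b; have [h|/existsNP [r hr]] := pselect (forall r,
      nC (sval (sval f r) (sval b) - sval (sval f r) (sval b0)) <= e).
    by exists 0.
  by exists r => _; rewrite ltNge; apply/negP.
(* Translation by [a b - s] carries the value at [a b] to the single point [s] where continuity is
   assumed. *)
have UU := ultra_fmap (fun b => a b - s) UF; set U := fmap _ F in UU.
pose V (b : BX X) : Tw X := exist _ _ (@Tcl_shift (a b - s)).
pose V0 : Tw X := exist _ _ (Tcl_act UU : Tcl (act U : OpsW X)).
have FF : Filter F := @filter_filter _ _ (@ultra_proper _ _ UF).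
have cV : V @ F --> V0.
  apply/initial_cvg; exact: ((act_cvg (act U : OpsW X) UU).2 erefl).
have FVE b c : Fjoint f s (c, V b) = sval (sval f (a b)) (sval c).
  by rewrite /Fjoint /= WW_shiftE addrCA subrr addr0.
have h1 : (fun b => Fjoint f s (b, V b)) @ F --> Fjoint f s (b0, V0).
  apply: (@cvg_comp _ _ _ (fun b : BXw X => (b, V b)) (Fjoint f s) F
    (nbhs (b0, V0))); last exact: cF.
  have idF : (fun b : BXw X => b) @ F --> b0 by [].
  exact: (@cvg_pair _ _ _ F _ _ FF (nbhs_filter b0) (nbhs_filter V0) _ _ idF cV).
have h2 : (fun b => Fjoint f s (b0, V b)) @ F --> Fjoint f s (b0, V0).
  apply: (@cvg_comp _ _ _ (fun b : BXw X => (b0, V b)) (Fjoint f s) F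
    (nbhs (b0, V0))); last exact: cF.
  have cF0 : (fun b : BXw X => b0) @ F --> b0 by exact: cvg_cst.
  exact: (@cvg_pair _ _ _ F _ _ FF (nbhs_filter b0) (nbhs_filter V0) _ _ cF0 cV).
move: h1 h2 => /cvg_ucv h1 /cvg_ucv h2.
have PF : ProperFilter F := @ultra_proper _ _ UF.
have h12 := @ucvB _ _ F PF _ _ _ _ h1 h2; rewrite subrr in h12.
have h3 := h12 e e0.
have [b [hb]] := filter_ex (@filterI _ F _ _ _ h3 nD).
move=> /ha; move: hb; rewrite /= !FVE subr0; lra.
Qed.

End JointContinuity.

Section AlmostPeriodicity.
Variables (R : realType) (X : completeNormedModType R[i]).

Lemma reversible_cauchy (f : WW X) (U : set_system R) (e : R) :
  reversible f -> totally_bounded_dual f -> UltraFilter U -> 0 < e ->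
  exists2 A, U A & forall t s r (b : BX X), A t -> A s ->
    nC (sval (sval f (r + t)) (sval b) - sval (sval f (r + s)) (sval b)) <= e.
Proof.
move=> rf tf UU e0; have e30 : 0 < e / 3 by lra.
have [L hL] := tf _ e30.
have /choice [A hA] : forall b : BX X, exists A, U A /\ forall t s r, A t -> A s ->
    nC (sval (sval f (r + t)) (sval b) - sval (sval f (r + s)) (sval b)) <= e / 3.
  by move=> b; have [A UA h] := reversible_scalar_cauchy (sval b) rf UU e30; exists A.
have FU : Filter U := @filter_filter _ _ (@ultra_proper _ _ UU).
have UB := @filter_seq _ _ U FU L A (fun b => (hA b).1).
refine (ex_intro2 _ _ _ UB _) => t s r b ht hs.
have [c cL hc] := hL b; have h0 := (hA c).2 t s r (ht c cL) (hs c cL).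
have h1 := hc (r + t); have h2 := hc (r + s); move: h0 h1 h2.
set x := sval _ (sval c); set y := sval _ (sval c).
set x' := sval _ (sval b); set y' := sval _ (sval b) => h0 h1 h2.
by have := nC_triangle x x' y'; have := nC_triangle y x y'; rewrite (nCC y y'); lra.
Qed.

Lemma sup_cvg (I : Type) (F : set_system I) {FF : Filter F} (w : I -> Rbidual_sup X)
    (h : Rbidual_sup X) :
  w @ F --> h <-> forall e : R, 0 < e ->
    F [set i | forall r (b : BX X), nC (sval (w i r) (sval b) - sval (h r) (sval b)) < e].
Proof.
rewrite initial_cvg; split=> [cw e e0|hw A].
  have nA : nbhs (sup_map h) [set k : {uniform (R * BX X) -> R[i]} |
      forall y, nC (k y - sup_map h y) < e].
    apply/uniform_nbhs; exists [set xy | nC (xy.2 - xy.1) < e]; split.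
      rewrite -entourage_ballE; exists e%:C%C; first by rewrite /= ltcR.
      by move=> [x y]; rewrite -ball_normE /ball_ /= distrC nCE ltcR.
    by move=> k hk y; exact: hk.
  by refine (filterSr (F := F) (cw _ nA) _) => i /= hi r b; exact: (hi (r, b)).
move=> /uniform_nbhs [E [eE EA]].
move: eE; rewrite -entourage_ballE => -[[e e'] /=].
rewrite ltcE /= => /andP[/eqP -> e0] hE.
refine (filterSr (F := F) (hw e e0) _) => i /= hi; apply: EA => -[r b] _; apply: hE.
by rewrite /= -ball_normE /ball_ /= distrC nCE ltcR; exact: hi.
Qed.

(** Uniform closeness along ultrafilters turns each [act U f] into a sup-norm limit of translates.
    Compactness of the set [K] of these limits comes from limits of ultrafilters, so completeness of
    the bidual is not invoked. *)
Lemma reversible_AP (f : WW X) : reversible f -> totally_bounded_dual f -> is_AP (sval f).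
Proof.
move=> rf tf; have [[_ fu] _] := svalP f; split.
  by move=> r e e0; have [d d0 hd] := fu e e0; exists d => // s; exact: hd.
pose tr t : Rbidual_sup X := fun r => sval f (r + t).
pose K : set (Rbidual_sup X) :=
  [set h | exists2 U : set_system R, UltraFilter U & h = sval (act U f)].
have cvU (U : set_system R) (e : R) : UltraFilter U -> 0 < e -> exists2 A, U A &
    forall t r (b : BX X), A t ->
    nC (sval (sval f (r + t)) (sval b) - sval (sval (act U f) r) (sval b)) <= e.
  move=> UU e0; have [A UA hA] := reversible_cauchy rf tf UU e0; exists A => // t r b At.
  have hU := actP f UU r (sval b).
  apply: (ucv_le (ucvB (ucv_cst (F := U) (sval (sval f (r + t)) (sval b))) hU)).
  by refine (filterSr (F := U) UA _) => s As; exact: hA.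
have tr_cvg (U : set_system R) : UltraFilter U -> tr @ U --> (sval (act U f) : Rbidual_sup X).
  move=> UU; apply/sup_cvg => e e0; have e20 : 0 < e / 2 by lra.
  have [A UA hA] := cvU U _ UU e20.
  by refine (filterSr (F := U) UA _) => t At r b; apply: le_lt_trans (hA t r b At) _; lra.
have cK : compact K.
  rewrite compact_ultra => F UF FK.
  have FF : Filter F := @filter_filter _ _ (@ultra_proper _ _ UF).
  have /choice [u hu] : forall h : Rbidual_sup X, exists U : set_system R,
      UltraFilter U /\ (K h -> h = sval (act U f)).
    move=> h; have [[U UU hU]|nK] := pselect (K h); first by exists U.
    by exists (principal_filter 0); split=> //; exact: principal_filter_ultra.
  (* The limit along [F] of the ultrafilters [u h]; the principal filter chosen outside [K] does not
     matter because [F] contains [K]. *)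
  pose U : set_system R := [set A | F [set h | u h A]].
  have UU : UltraFilter U.
    have PU : ProperFilter U.
      split.
        move=> h0; have [h] := @filter_ex _ F _ _ h0.
        by have [Uh _] := hu h; have [] := @ultra_proper _ _ Uh.
      split.
      - by apply: (@filterE _ F) => h; have [Uh _] := hu h; exact: filterT.
      - move=> A B FA FB; refine (filterSr (F := F) (@filterI _ F _ _ _ FA FB) _) => h [].
        by have [Uh _] := hu h; exact: filterI.
      - move=> A B AB FA; refine (filterSr (F := F) FA _) => h.
        by have [Uh _] := hu h; exact: filterS.
    split=> // G PG UG; rewrite eqEsubset; split=> // A GA; apply: contrapT => nA.
    have : U (~` A).
      refine (filterSr (F := F) (ultra_setC UF nA) _) => h /= nh.
      by have [Uh _] := hu h; exact: ultra_setC nh.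
    by move=> /UG GnA; have [x []] := filter_ex (filterI GA GnA).
  exists (sval (act U f)); split; first by exists U.
  suff : (fun h : Rbidual_sup X => h) @ F --> (sval (act U f) : Rbidual_sup X) by [].
  apply/sup_cvg => e e0; have e30 : 0 < e / 3 by lra.
  have [A UA hA] := reversible_cauchy rf tf UU e30.
  have [B UB hB] := cvU U _ UU e30.
  have [t [At Bt]] := filter_ex (filterI UA UB).
  refine (filterSr (F := F) (@filterI _ F _ _ _ FK UA) _) => h [Kh /= uA] r b.
  have [Uh /(_ Kh) ->] := hu h; have hh := actP f Uh r (sval b).
  have h1 : nC (sval (sval f (r + t)) (sval b) - sval (sval (act (u h) f) r) (sval b)) <= e / 3.
    apply: (ucv_le (ucvB (ucv_cst (F := u h) (sval (sval f (r + t)) (sval b))) hh)).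
    by refine (filterSr (F := u h) uA _) => s As; exact: hA.
  have h2 := hB t r b Bt; move: h1 h2.
  set x := sval _ (sval b); set y := sval _ (sval b); set z := sval _ (sval b) => h1 h2.
  by have := nC_triangle x y z; rewrite (nCC y x); lra.
apply: (subclosed_compact _ cK); first exact: closed_closure.
move=> h clh.
have PF : ProperFilter (filter_from (nbhs h) (fun B => tr @^-1` B)).
  apply: filter_from_proper.
    apply: filter_from_filter; first by exists setT; exact: filterT.
    by move=> A B hA hB; exists (A `&` B) => //; exact: filterI.
  by move=> B /clh [_ [[t ->] Bt]]; exists t.
have [U [UU sU]] := ultraFilterLemma PF.
have FU : Filter U := @filter_filter _ _ (@ultra_proper _ _ UU).
exists U => //.
have cvh : tr @ U --> h by move=> B hB; apply: sU; exists B.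
have /sup_cvg h1 := cvh; have /sup_cvg h2 := tr_cvg U UU.
apply/funext => r; apply: sval_inj; apply/funext => p.
apply/eqP; rewrite -subr_eq0; apply/eqP/nC_eq0/eqP; rewrite eq_le nC_ge0 andbT.
(* The sup topology sees only the unit ball, so equality there is extended to every [p] through the
   norm of the difference. *)
apply: le_trans (bnorm_ub p (is_bidual_sub (h r) (sval (act U f) r))) _.
apply: mulr_le0_ge0; last exact: dnorm_ge0 (svalP p).
apply: bnorm_le => c c1; pose b : BX X := exist _ c c1.
have u1 : ucv U (fun t => sval (tr t r) c) (sval (h r) c).
  by move=> e e0; refine (filterSr (F := U) (h1 e e0) _) => t /(_ r b).
have u2 : ucv U (fun t => sval (tr t r) c) (sval (sval (act U f) r) c).
  by move=> e e0; refine (filterSr (F := U) (h2 e e0) _) => t /(_ r b).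
by rewrite /bidual_sub (ucv_unique u1 u2) subrr nC0.
Qed.

End AlmostPeriodicity.

Theorem theorem8p4 (R : realType) (X : completeNormedModType R[i])
  (P : OpsW X) (hP : minimal_idempotent P)
  (f : WW X) (hf : WW_a P f)
  (hsep : norm_separable (closure (range (sval f) : set (bidual_w X))))
  (hF : exists s : R, continuous (Fjoint f s)) :
  is_AP (sval f).
Proof.
have [s cF] := hF; apply: reversible_AP.
  by move=> U UU; exact: minimal_idempotent_reversible hP hf UU.
exact: joint_continuity_totally_bounded cF.
Qed.
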